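(* For every integer $n\ge 6$, $\alpha_M(3,n)=\left\lfloor\frac{n-2}{2}\right\rfloor$.
   Context: For a graph $G$, $\alpha(G)$ is the maximum size of a stable set (set of pairwise non-adjacent vertices) and $\mathit{cl}(G)$ is the clique complex of $G$ (simplicial complex of cliques). Define $$\alpha_M(d,n)=\max\{\alpha(G): |V(G)|=n,\ \mathit{cl}(G)\text{ triangulates the }(d-1)\text{-dimensional sphere}\}.$$ *)

(* Defs.v *)
From HB Require Import structures.
From mathcomp Require Import all_boot all_order all_algebra.
From mathcomp Require Import all_classical reals topology normedtype.

Set Implicit Arguments.
Unset Strict Implicit.
Unset Printing Implicit Defensive.

Import Order.TTheory GRing.Theory Num.Theory.
Import numFieldNormedType.Exports.

Local Open Scope classical_set_scope.
Local Open Scope ring_scope.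

(* Finite simple graphs on the vertex set {0, ..., n-1}: an edge is an
   unordered pair of distinct vertices. *)
Record sgraph (n : nat) := SGraph {
  edges : {set {set 'I_n}};
  edgesP : [forall e in edges, #|e| == 2%N]
}.

HB.instance Definition _ n := [isSub for @edges n].
HB.instance Definition _ n := [Finite of sgraph n by <:].

Definition adjacent n (G : sgraph n) (x y : 'I_n) : bool :=
  [set x; y]%SET \in edges G.

Definition stable n (G : sgraph n) (A : {set 'I_n}) : bool :=
  [forall x in A, forall y in A, ~~ adjacent G x y].

Definition alpha n (G : sgraph n) : nat :=
  \max_(A : {set 'I_n} | stable G A) #|A|.

Definition clique n (G : sgraph n) (A : {set 'I_n}) : bool :=
  [forall x in A, forall y in A, (x != y) ==> adjacent G x y].

(* The empty face is included; it contributes no point to the geometric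
   realization. *)
Definition clique_complex n (G : sgraph n) : {set {set 'I_n}} :=
  [set A | clique G A]%SET.

(* Geometric realization with vertex i placed at the i-th standard basis
   vector of R^n: the points given by barycentric coordinates x whose support
   is a face. *)
Definition realization (R : realType) n (K : {set {set 'I_n}}) :
    set 'rV[R]_n :=
  [set x : 'rV[R]_n | [/\ forall i, 0 <= x ord0 i,
                          \sum_i x ord0 i = 1
                        & [set i | x ord0 i != 0]%SET \in K]].

Arguments realization R {n} K.

(* The unit sphere of R^d, of dimension d - 1. *)
Definition unit_sphere (R : realType) (d : nat) : set 'rV[R]_d :=
  [set x : 'rV[R]_d | \sum_i x ord0 i ^+ 2 = 1].

Arguments unit_sphere R d : clear implicits.

(* A and B carry the subspace topologies; the values of f outside A and of g
   outside B are irrelevant. *)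
Definition homeomorphic (X Y : topologicalType) (A : set X) (B : set Y) :
    Prop :=
  exists (f : X -> Y) (g : Y -> X),
    [/\ {within A, continuous f} /\ {within B, continuous g},
        f @` A `<=` B /\ g @` B `<=` A,
        {in A, cancel f g}
      & {in B, cancel g f}].

Definition triangulates_sphere (R : realType) (d n : nat)
    (K : {set {set 'I_n}}) : Prop :=
  homeomorphic (realization R K) (unit_sphere R d).

(* The maximum is 0 when no graph on n vertices qualifies. *)
Definition alphaM (R : realType) (d n : nat) : nat :=
  \max_(G : sgraph n | `[< triangulates_sphere R d (clique_complex G) >])
    alpha G.

(* Main.v *)
Require Import Defs.
From mathcomp Require Import all_boot all_order all_algebra.
From mathcomp Require Import all_classical reals interval_inference topology.
From mathcomp Require Import normedtype derive realfun trigo.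
From mathcomp Require Import zify ring lra.

(* Upper bound.  Let |K| be homeomorphic to the sphere; removing a point gives a
   homeomorphism of the rest with the plane.  A map P from the plane to symmetric
   rank-one matrices has a continuous root w, P = w w^T (lift along rays).  With
   2 x 2 matrices, i.e. square roots of planar maps, this shows that a nowhere
   zero planar map is not odd on the unit circle, which yields both invariance of
   domain in the plane and the fact that a punctured half-disc contains no small
   circle around the puncture.  Hence every edge lies in exactly two triangles and
   there is no 4-clique, so every vertex lies in at least four triangles.  For a
   mod 2 cocycle s, rooting ((-1)^s(u,v) x_u x_v) in barycentric coordinates shows
   that s is a coboundary.  Linear algebra over F_2 then gives E - (n - 1) <= F - 1,
   and 3 F = 2 E, so F <= 2 n - 4; a triangle contains at most one vertex of a
   stable set S, so 4 |S| <= F.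
   Lower bound.  The suspension of an (n - 2)-cycle is a sphere: it is obtained
   from the octahedron by subdividing equatorial edges. *)

Set Implicit Arguments.
Unset Strict Implicit.
Unset Printing Implicit Defensive.

Import Order.TTheory GRing.Theory Num.Theory.
Import numFieldNormedType.Exports.

Local Open Scope classical_set_scope.
Local Open Scope ring_scope.

(** * Continuity of elementary expressions *)

Section Continuity.
Context {R : realType} {T : topologicalType}.
Implicit Types f g : T -> R.

(** A matrix w w^T determines w only up to sign, so choosing w continuously is lifting through a
    double cover, and the plane has no nontrivial double cover. This one fact replaces winding
    numbers (2 x 2 matrices, complex square roots) as well as the vanishing of the first mod 2
    cohomology (one matrix index per vertex). Only half of Euler's formula is needed, V - E + F >=
    2. Both -1 in the rank estimate come from all-ones vectors: an edge has two ends and lies in two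
    triangles, and 2 = 0 in F_2. Flagness makes a 4-clique a solid tetrahedron, which the local
    argument excludes; no vertex link is then a triangle, whence the factor 4. A homeomorphism is
    continuous only within its sets. Auxiliary maps are therefore extended to a whole plane or line
    by truncations (min, max), and the point removed for a chart is always chosen off the set under
    study. *)

Lemma continuous_add f g : continuous f -> continuous g ->
  continuous (fun x => f x + g x).
Proof. by move=> cf cg x; apply: cvgD; [exact: cf|exact: cg]. Qed.

Lemma continuous_opp f : continuous f -> continuous (fun x => - f x).
Proof. by move=> cf x; apply: cvgN; exact: cf. Qed.

Lemma continuous_mul f g : continuous f -> continuous g ->
  continuous (fun x => f x * g x).
Proof. by move=> cf cg x; apply: cvgM; [exact: cf|exact: cg]. Qed.

Lemma continuous_exp f n : continuous f -> continuous (fun x => f x ^+ n).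
Proof.
move=> cf; elim: n => [|n IH]; first by move=> x; exact: cvg_cst.
by under eq_fun do rewrite exprS; exact: continuous_mul.
Qed.

Lemma continuous_inv f : (forall x, f x != 0) -> continuous f ->
  continuous (fun x => (f x)^-1).
Proof. by move=> f0 cf x; apply: cvgV; [exact: f0|exact: cf]. Qed.

Lemma continuous_abs f : continuous f -> continuous (fun x => `|f x|).
Proof. by move=> cf x; apply: cvg_norm; exact: cf. Qed.

Lemma continuous_sqrt f : continuous f -> continuous (fun x => Num.sqrt (f x)).
Proof.
move=> cf x; apply: (@continuous_comp _ _ _ f); first exact: cf.
exact: sqrt_continuous.
Qed.

Lemma continuous_maxr f g : continuous f -> continuous g ->
  continuous (fun x => Num.max (f x) (g x)).
Proof. by move=> cf cg x; apply: continuous_max; [exact: cf|exact: cg]. Qed.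

Lemma continuous_minr f g : continuous f -> continuous g ->
  continuous (fun x => Num.min (f x) (g x)).
Proof. by move=> cf cg x; apply: continuous_min; [exact: cf|exact: cg]. Qed.

Lemma continuous_const (U : topologicalType) (c : U) : continuous (fun _ : T => c).
Proof. by move=> x; exact: cvg_cst. Qed.

Lemma continuous_sumr (I : finType) (P : pred I) (F : I -> T -> R) :
  (forall i, P i -> continuous (F i)) ->
  continuous (fun x => \sum_(i | P i) F i x).
Proof.
move=> cF x; apply: (@cvg_big R I +%R 0 P add_continuous) => i Pi; exact: cF.
Qed.

Lemma continuous_pair (U V : topologicalType) (f : T -> U) (g : T -> V) :
  continuous f -> continuous g -> continuous (fun x => (f x, g x)).
Proof. by move=> cf cg x; apply: cvg_pair; [exact: cf|exact: cg]. Qed.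

Lemma continuous_fst (U V : topologicalType) (f : T -> U * V) :
  continuous f -> continuous (fun x => (f x).1).
Proof.
by move=> cf x; apply: (@continuous_comp _ _ _ f); [exact: cf|exact: cvg_fst].
Qed.

Lemma continuous_snd (U V : topologicalType) (f : T -> U * V) :
  continuous f -> continuous (fun x => (f x).2).
Proof.
by move=> cf x; apply: (@continuous_comp _ _ _ f); [exact: cf|exact: cvg_snd].
Qed.

Lemma continuous_coord n (f : T -> 'rV[R]_n) i :
  continuous f -> continuous (fun x => f x ord0 i).
Proof.
move=> cf x; apply: (@continuous_comp _ _ _ f (fun M : 'rV[R]_n => M ord0 i)).
  exact: cf.
exact: coord_continuous.
Qed.

Lemma continuous_row n (f : T -> 'I_n -> R) :
  (forall i, continuous (fun x => f x i)) ->
  continuous (fun x => \row_i f x i).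
Proof.
move=> cf x; apply/cvgrPdist_lt => e e0.
have : \forall y \near x, forall i, `|f x i - f y i| < e.
  apply: filter_forall => i.
  by have /cvgrPdist_lt/(_ e e0) := cf i x.
apply: filterS => y H; rewrite -[ltLHS]/(mx_norm _) mx_normrE.
apply/bigmax_ltP; split => // -[i j] _ /=.
by rewrite !mxE.
Qed.

(** Turns continuity within a set into plain continuity, once the inner map stays in the set. All
    uses of a homeomorphism pass through such compositions. *)
Lemma continuous_within_comp (U V : topologicalType) (A : set U) (F : U -> V)
    (f : T -> U) :
  {within A, continuous F} -> continuous f -> (forall t, A (f t)) ->
  continuous (fun t => F (f t)).
Proof.
move=> /subspace_continuousP cF cf Af t.
move=> W HW.
have {}HW : nbhs (f t) [set u | A u -> W (F u)].
  exact: (cF (f t) (Af t) W HW).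
have := cf t _ HW; rewrite !nbhs_simpl /=.
by apply: filterS => s /=; apply; exact: Af.
Qed.

Lemma continuous_compose (U V : topologicalType) (f : T -> U) (g : U -> V) :
  continuous g -> continuous f -> continuous (fun x => g (f x)).
Proof.
by move=> cg cf x; apply: (@continuous_comp _ _ _ f g); [exact: cf|exact: cg].
Qed.

End Continuity.

Ltac cont_step :=
  lazymatch goal with
  | |- continuous fst => move=> ?; exact: cvg_fst
  | |- continuous snd => move=> ?; exact: cvg_snd
  | |- continuous (fun x => x) => move=> ?; exact: cvg_id
  | |- continuous (fun _ => ?c) => exact: continuous_const
  | |- continuous (fun x => @?f x + @?g x) => apply: (@continuous_add _ _ f g)
  | |- continuous (fun x => - @?f x) => apply: (@continuous_opp _ _ f)
  | |- continuous (fun x => @?f x * @?g x) => apply: (@continuous_mul _ _ f g)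
  | |- continuous (fun x => @?f x ^+ _) => apply: (@continuous_exp _ _ f)
  | |- continuous (fun x => (@?f x)^-1) => apply: (@continuous_inv _ _ f)
  | |- continuous (fun x => `| @?f x |) => apply: (@continuous_abs _ _ f)
  | |- continuous (fun x => Num.sqrt (@?f x)) => apply: (@continuous_sqrt _ _ f)
  | |- continuous (fun x => Num.max (@?f x) (@?g x)) =>
      apply: (@continuous_maxr _ _ f g)
  | |- continuous (fun x => Num.min (@?f x) (@?g x)) =>
      apply: (@continuous_minr _ _ f g)
  | |- continuous (fun x => (@?f x, @?g x)) =>
      apply: (@continuous_pair _ _ _ f g)
  | |- continuous (fun x => (@?f x).1) => apply: (@continuous_fst _ _ _ f)
  | |- continuous (fun x => (@?f x).2) => apply: (@continuous_snd _ _ _ f)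
  | |- continuous (fun x => fun_of_matrix (@?f x) ord0 ?i) =>
      apply: (@continuous_coord _ _ _ f)
  | |- continuous (fun x => \sum_(_ | _) _) => apply: continuous_sumr => ? _
  | |- continuous (fun x => \row__ _) => apply: continuous_row => ?
  end.
Ltac cont := repeat first [assumption | progress cbv beta | cont_step].

(** * Continuous roots of rank-one matrices *)

Section RankOne.
Context {R : realType} (I : finType).
Implicit Types (p : I -> I -> R * R -> R) (w : I -> R).

Definition is_root (m : I -> I -> R) (w : I -> R) := forall i j, m i j = w i * w j.

(** The trace pairing of rank-one matrices does not see the signs of the roots, and it is positive
    exactly when the roots are not orthogonal. *)
Lemma pairing_roots (m m' : I -> I -> R) w w' :
  is_root m w -> is_root m' w' ->
  \sum_i \sum_j m i j * m' i j = (\sum_i w i * w' i) ^+ 2.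
Proof.
move=> rw rw'; rewrite expr2 mulr_suml; apply: eq_bigr => i _.
by rewrite mulr_sumr; apply: eq_bigr => j _; rewrite rw rw'; ring.
Qed.

(** Applying [m'] to [w] gives d [w'], with d the scalar product of [w] and [w'], and the
    denominator is |d|. The quotient is whichever of [w'] and its opposite makes an acute angle with
    [w]. The formula does not mention [w'], so it is continuous in its data. *)
Lemma root_step (m m' : I -> I -> R) w :
  is_root m w -> (exists w', is_root m' w') ->
  0 < \sum_i \sum_j m i j * m' i j ->
  is_root m' (fun i => (\sum_j m' i j * w j) /
                Num.sqrt (\sum_i \sum_j m i j * m' i j)).
Proof.
move=> rw [w' rw']; rewrite (pairing_roots rw rw').
set d := \sum_i w i * w' i => d0.
have E i : \sum_j m' i j * w j = w' i * d.
  by rewrite mulr_sumr; apply: eq_bigr => j _; rewrite rw'; ring.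
move=> i j; rewrite !E mulrACA -invfM -expr2 sqr_sqrtr ?ltW// rw'.
by field; apply/eqP => d00; rewrite d00 expr0n ltxx in d0.
Qed.

Definition clamp (M a : R) : R := Num.max (- M) (Num.min M a).

Lemma clamp_bound M a : 0 <= M -> - M <= clamp M a <= M.
Proof.
move=> M0; rewrite le_max lexx /= ge_max ge_min lexx /= andbT.
by rewrite ge0_cp.
Qed.

Lemma clamp_id M a : `|a| <= M -> clamp M a = a.
Proof.
by rewrite ler_norml /clamp => /andP[h1 h2]; rewrite (min_idPr h2) (max_idPr h1).
Qed.

Lemma continuous_clamp (T : topologicalType) (f : T -> R) M :
  continuous f -> continuous (fun x => clamp M (f x)).
Proof. by move=> cf; rewrite /clamp; cont. Qed.

(** The pairing is positive for t = t' because roots are nonzero. Compactness of the square times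
    [0, 1] then gives one step length valid on all rays, the analogue of a Lebesgue number in path
    lifting. *)
Lemma uniform_pairing p (M : R) :
  (forall i j, continuous (p i j)) ->
  (forall x, exists w, (exists i, w i != 0) /\ is_root (fun i j => p i j x) w) ->
  0 <= M ->
  exists N : nat, forall (x : R * R) (t t' : R), `|x.1| <= M -> `|x.2| <= M ->
    0 <= t <= 1 -> `|t - t'| <= N.+1%:R^-1 ->
    0 < \sum_i \sum_j p i j (t * x.1, t * x.2) * p i j (t' * x.1, t' * x.2).
Proof.
move=> cp rp M0.
pose H (z : ((R * R) * R) * R) : R := \sum_i \sum_j
  p i j (z.1.2 * z.1.1.1, z.1.2 * z.1.1.2) * p i j (z.2 * z.1.1.1, z.2 * z.1.1.2).
have cH : continuous H.
  apply: continuous_sumr => i _; apply: continuous_sumr => j _.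
  by apply: continuous_mul; apply: (@continuous_compose _ _ _ _ (p i j)) => //; cont.
have H0 x t : 0 < H ((x, t), t).
  have [w [[i wi] rw]] := rp (t * x.1, t * x.2).
  rewrite /H /= (pairing_roots rw rw) exprn_gt0//.
  rewrite (bigD1 i)//= -expr2 ltr_wpDr ?sumr_ge0//.
    by move=> j _; rewrite -expr2 sqr_ge0.
  by rewrite lt0r sqrf_eq0 wi sqr_ge0.
pose K := (`[-M, M] `*` `[-M, M]) `*` `[0 : R, 1].
have cK : compact K.
  by apply: compact_setX; [apply: compact_setX|]; exact: segment_compact.
pose P (k : nat) (y : (R * R) * R) :=
  forall t', `|y.2 - t'| <= k.+1%:R^-1 -> 0 < H (y, t').
(* Compactness in near-covering form, with the filter [\oo] on step counts, turns the local step
   lengths into a single [N]. *)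
have := (compact_near_coveringP K).1 cK nat \oo P _ _.
case.
- move=> [x t] _.
  have : \forall z \near ((x, t), t), 0 < H z.
    exact: (cvgr_gt _ (cH ((x, t), t)) _ (H0 x t)).
  move=> [[U V] /= [xU tV] UV].
  have [e /= e0 eV] := (nbhs_ballP _ _).1 tV.
  exists (U `&` [set y | ball t (e / 2) y.2],
          [set k : nat | k.+1%:R^-1 < e / 2]) => /=.
    split.
      apply: filterI => //.
      have : (fun y : (R * R) * R => y.2) @ nbhs (x, t) --> t by exact: cvg_snd.
      by apply; apply: nbhsx_ballx; rewrite divr_gt0.
    have e2 : 0 < e / 2 by rewrite divr_gt0.
    exact: (near_infty_natSinv_lt (PosNum e2)).
  move=> [[y s] k] /= [[Uy bs] ke] t'; rewrite /= in bs ke * => st'.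
  apply: (UV ((y, s), t')); split => //=.
  apply: eV; rewrite /ball /= in bs *.
  have -> : t - t' = (t - s) + (s - t') by ring.
  by apply: le_lt_trans (ler_normD _ _) _; rewrite (splitr e) ltrD// (le_lt_trans st').
- move=> N _ HN; exists N => x t t' x1 x2 t01 tt'.
  apply: (HN N _ ((x, t)) _ t') => //=.
  by split; [split|]; rewrite /= in_itv //= -ler_norml.
Qed.

Lemma continuous_root p (M : R) :
  (forall i j, continuous (p i j)) ->
  (forall x, exists w, (exists i, w i != 0) /\ is_root (fun i j => p i j x) w) ->
  0 <= M ->
  exists w : I -> R * R -> R, (forall i, continuous (w i)) /\
    forall x, `|x.1| <= M -> `|x.2| <= M ->
      is_root (fun i j => p i j x) (fun i => w i x).
Proof.
move=> cp rp M0; have [N HN] := uniform_pairing cp rp M0.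
pose y (k : nat) (x : R * R) : R * R :=
  (k%:R / N.+1%:R * clamp M x.1, k%:R / N.+1%:R * clamp M x.2).
have cy k : continuous (y k).
  by rewrite /y; cont; apply: continuous_clamp; cont.
have N0 : (N.+1%:R : R) != 0 by rewrite pnatr_eq0.
suff H k : (k <= N.+1)%N -> exists w : I -> R * R -> R,
    (forall i, continuous (w i)) /\
    forall x, is_root (fun i j => p i j (y k x)) (fun i => w i x).
  have [w [cw rw]] := H N.+1 (leqnn _).
  exists w; split=> // x x1 x2; have := rw x.
  by rewrite /y !clamp_id// divff// !mul1r -surjective_pairing.
elim: k => [_|k IH kN].
  have [w [_ rw]] := rp (0, 0).
  exists (fun i _ => w i); split=> [i|x]; first by cont.
  by rewrite /y !mul0r.
have [w [cw rw]] := IH (ltnW kN).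
pose s (x : R * R) := \sum_i \sum_j p i j (y k x) * p i j (y k.+1 x).
have s0 x : 0 < s x.
  have /andP[a1 a2] := clamp_bound x.1 M0; have /andP[b1 b2] := clamp_bound x.2 M0.
  apply: (HN (clamp M x.1, clamp M x.2)) => /=.
  - by rewrite ler_norml a1.
  - by rewrite ler_norml b1.
  - rewrite divr_ge0 ?ler0n//= ler_pdivrMr ?ltr0n// mul1r ler_nat; exact: ltnW.
  - by rewrite distrC -mulrBl -natrB// subSnn mul1r ger0_norm// invr_ge0 ler0n.
exists (fun i x => (\sum_j p i j (y k.+1 x) * w j x) / Num.sqrt (s x)); split=> [i|x].
  apply: continuous_mul.
    apply: continuous_sumr => j _; apply: continuous_mul => //.
    by apply: (@continuous_compose _ _ _ _ (p i j)).
  apply: continuous_inv; first by move=> x; rewrite sqrtr_eq0 -ltNge.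
  apply: continuous_sqrt; apply: continuous_sumr => a _; apply: continuous_sumr => b _.
  by apply: continuous_mul; apply: (@continuous_compose _ _ _ _ (p a b)).
apply: (root_step (rw x)); last exact: s0.
by have [v [_ rv]] := rp (y k.+1 x); exists v.
Qed.

End RankOne.

(** * Odd planar maps *)

Section BorsukUlam.
Context {R : realType}.

Lemma ivt_same_sign (c : R -> R) (a b : R) : a <= b -> continuous c ->
  (forall t, a <= t <= b -> c t != 0) -> 0 < c a * c b.
Proof.
move=> ab cc c0; rewrite ltNge; apply/negP => H.
have [|t] := @IVT R c a b 0 ab (continuous_subspaceT cc).
  by case: (leP (c a) (c b)) => h; apply/andP; split; nra.
by rewrite in_itv/= => /c0 /negP tc /eqP.
Qed.

Definition opp_plane (x : R * R) : R * R := (- x.1, - x.2).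

(** Here u + iv is a complex square root of 2(a + ib): u^2 - v^2 = 2a and 2uv = 2b. The witness
    takes u >= 0 and gives v the sign of b. *)
Lemma planar_square_root (a b : R) : (a != 0) || (b != 0) ->
  exists u v : R, [/\ (u != 0) || (v != 0), u ^+ 2 = Num.sqrt (a ^+ 2 + b ^+ 2) + a,
    v ^+ 2 = Num.sqrt (a ^+ 2 + b ^+ 2) - a & u * v = b].
Proof.
move=> ab; set r := Num.sqrt _.
have ra : r ^+ 2 = a ^+ 2 + b ^+ 2 by rewrite sqr_sqrtr// addr_ge0// sqr_ge0.
have r0 : 0 <= r by exact: sqrtr_ge0.
have r1 : 0 < r.
  rewrite sqrtr_gt0; case/orP: ab => h.
    by rewrite ltr_pwDl ?sqr_ge0// lt0r sqrf_eq0 h sqr_ge0.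
  by rewrite ltr_wpDl ?sqr_ge0// lt0r sqrf_eq0 h sqr_ge0.
have : `|a| <= r by rewrite -sqrtr_sqr ler_wsqrtr// lerDl sqr_ge0.
rewrite ler_norml => /andP[ra1 ra2].
have p1 : 0 <= r + a by lra.
have p2 : 0 <= r - a by lra.
exists (Num.sqrt (r + a)), ((-1) ^+ (b < 0)%R * Num.sqrt (r - a)).
have E1 : Num.sqrt (r + a) ^+ 2 = r + a by rewrite sqr_sqrtr.
have E2 : ((-1) ^+ (b < 0)%R * Num.sqrt (r - a)) ^+ 2 = r - a.
  by rewrite exprMn sqrr_sign mul1r sqr_sqrtr.
split=> //.
  apply/negPn/negP; rewrite negb_or !negbK => /andP[/eqP h1 /eqP h2].
  by move: E1 E2; rewrite h1 h2 expr0n /=; lra.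
rewrite mulrCA -sqrtrM// (_ : (r + a) * (r - a) = b ^+ 2).
  rewrite sqrtr_sqr; case: ltP => h; first by rewrite ltr0_norm//; ring.
  by rewrite ger0_norm//; ring.
by rewrite mulrC -subr_sqr ra; ring.
Qed.

(** Let w be a continuous square root of 2 (G1 + i G2), seen as a planar vector. The determinant of
    w(x) and w(-x) never vanishes on the circle, yet half a turn exchanges the two vectors and
    reverses its sign. *)
Lemma no_odd_map (G1 G2 : R * R -> R) : continuous G1 -> continuous G2 ->
  (forall x, (G1 x != 0) || (G2 x != 0)) ->
  (forall x, x.1 ^+ 2 + x.2 ^+ 2 = 1 ->
    G1 (opp_plane x) = - G1 x /\ G2 (opp_plane x) = - G2 x) -> False.
Proof.
move=> c1 c2 G0 Godd.
pose r x := Num.sqrt (G1 x ^+ 2 + G2 x ^+ 2).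
pose p (i j : bool) x := if i (+) j then G2 x else r x + (if i then G1 x else - G1 x).
have cp i j : continuous (p i j).
  by rewrite /p /r; case: i; case: j => /=; cont.
have rp x : exists w : bool -> R, (exists i, w i != 0) /\ is_root (fun i j => p i j x) w.
  have [u [v [uv Eu Ev Euv]]] := planar_square_root (G0 x).
  exists (fun i => if i then u else v); split.
    by case/orP: uv; [exists true|exists false].
  by case; case; rewrite /p /= -?Euv -?expr2 ?Eu ?Ev // mulrC.
have [w [cw rw]] := continuous_root cp rp ler01.
pose pt (t : R) : R * R := (cos t, sin t).
have cpt : continuous pt.
  by apply: continuous_pair; [exact: continuous_cos|exact: continuous_sin].
have bnd t : `|cos t| <= 1 /\ `|sin t| <= 1 :> R.
  by rewrite !ler_norml cos_le1 cos_geN1 sin_le1 sin_geN1.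
have rw1 t := rw (pt t) (bnd t).1 (bnd t).2.
have rw2 t : is_root (fun i j => p i j (opp_plane (pt t))) (fun i => w i (opp_plane (pt t))).
  by apply: rw; rewrite /= normrN; have [] := bnd t.
have odd t : G1 (opp_plane (pt t)) = - G1 (pt t) /\ G2 (opp_plane (pt t)) = - G2 (pt t).
  by apply: Godd; rewrite /= cos2Dsin2.
(* [w (- x)] is [w x] turned by a right angle, up to sign, because
   the squares of these planar vectors are opposite. *)
pose c t := w true (pt t) * w false (opp_plane (pt t)) -
            w false (pt t) * w true (opp_plane (pt t)).
have cc : continuous c.
  have co : continuous (fun t => opp_plane (pt t)).
    by rewrite /opp_plane; cont.
  by rewrite /c; cont; apply: (@continuous_compose _ _ _ _ (w _)).
have c0 t : c t != 0.
  have [o1 o2] := odd t.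
  have := rw1 t true true; have := rw1 t true false; have := rw1 t false false.
  have := rw2 t true true; have := rw2 t true false; have := rw2 t false false.
  rewrite /p /= /r o1 o2 !sqrrN -/(r (pt t)).
  have r2 : r (pt t) ^+ 2 = G1 (pt t) ^+ 2 + G2 (pt t) ^+ 2.
    by rewrite sqr_sqrtr// addr_ge0// sqr_ge0.
  have : 0 < r (pt t) ^+ 2.
    rewrite r2; case/orP: (G0 (pt t)) => h.
      by rewrite ltr_pwDl ?sqr_ge0// lt0r sqrf_eq0 h sqr_ge0.
    by rewrite ltr_wpDl ?sqr_ge0// lt0r sqrf_eq0 h sqr_ge0.
  move=> r0 e1 e2 e3 e4 e5 e6; apply/eqP => ct0.
  (* With G odd, the products of the coordinates give c^2 = (r + G1)^2 + (r - G1)^2 + 2 G2^2 = 4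
     r^2. *)
  have : c t ^+ 2 = 4 * r (pt t) ^+ 2.
    rewrite /c sqrrB !exprMn !expr2 -e1 -e3 -e4 -e6.
    rewrite (_ : _ *+ 2 = 2 * ((w true (pt t) * w false (pt t)) *
      (w true (opp_plane (pt t)) * w false (opp_plane (pt t))))); last by ring.
    rewrite -e2 -e5.
    have -> : 4 * r (pt t) ^+ 2 = 2 * r (pt t) ^+ 2 + 2 * (G1 (pt t) ^+ 2 + G2 (pt t) ^+ 2).
      by rewrite -r2; ring.
    ring.
  by rewrite ct0 expr0n /=; lra.
have cpi : c pi = - c 0.
  have E1 : pt pi = opp_plane (pt 0).
    by rewrite /pt /opp_plane /= cospi sinpi cos0 sin0 oppr0.
  have E2 : opp_plane (pt pi) = pt 0.
    by rewrite E1 /opp_plane /= !opprK.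
  by rewrite /c E2 E1; ring.
have := ivt_same_sign (pi_ge0 R) cc (fun t _ => c0 t).
by rewrite cpi mulrN oppr_gt0 -expr2 ltNge sqr_ge0.
Qed.

End BorsukUlam.

(** * Invariance of domain in the plane *)

Section OpenImage.
Context {R : realType}.

Definition unit_disc (x : R * R) := x.1 ^+ 2 + x.2 ^+ 2 <= 1.

Definition sqdist (x y : R * R) := (x.1 - y.1) ^+ 2 + (x.2 - y.2) ^+ 2.

Lemma sqdist_gt0 x y : x <> y -> 0 < sqdist x y.
Proof.
move=> xy; rewrite lt0r addr_ge0 ?sqr_ge0// andbT paddr_eq0 ?sqr_ge0//.
rewrite !sqrf_eq0 !subr_eq0; apply/negP => /andP[/eqP h1 /eqP h2]; apply: xy.
by rewrite (surjective_pairing x) (surjective_pairing y) h1 h2.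
Qed.

Definition scale_plane (k : R) (x : R * R) : R * R := (k * x.1, k * x.2).

Lemma unit_disc_scale k x : unit_disc x -> -1 <= k <= 1 -> unit_disc (scale_plane k x).
Proof.
rewrite /unit_disc /= !exprMn -mulrDr => h /andP[k1 k2].
apply: le_trans h; rewrite ler_piMl ?addr_ge0 ?sqr_ge0//.
by rewrite expr2; nra.
Qed.

Lemma coord_le1 (a b : R) : a ^+ 2 + b ^+ 2 = 1 -> -1 <= a <= 1.
Proof.
move=> ab; rewrite -ler_norml -(ler_pXn2r (ltn0Sn 1)) ?nnegrE// expr1n.
by rewrite real_normK ?num_real//; have := sqr_ge0 b; lra.
Qed.

(** The points s e and (s - 1) e lie in the disc at distance 1, so injectivity separates their
    images and compactness makes this uniform. As s falls from 1 to 1/2 the pair moves from (e, 0)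
    to the antipodal pair (e/2, -e/2). *)
Lemma antipodal_gap (f : R * R -> R * R) : continuous f ->
  {in [set x | unit_disc x] &, injective f} ->
  exists2 m, 0 < m & forall e s, e.1 ^+ 2 + e.2 ^+ 2 = 1 -> 2^-1 <= s <= 1 ->
    m <= sqdist (f (scale_plane s e)) (f (scale_plane (s - 1) e)).
Proof.
move=> cf injf.
pose h (z : (R * R) * R) :=
  sqdist (f (scale_plane z.2 z.1)) (f (scale_plane (z.2 - 1) z.1)).
have ch : continuous h.
  have c1 : continuous (fun z : (R * R) * R => f (scale_plane z.2 z.1)).
    by apply: (@continuous_compose _ _ _ _ f) => //; rewrite /scale_plane; cont.
  have c2 : continuous (fun z : (R * R) * R => f (scale_plane (z.2 - 1) z.1)).
    by apply: (@continuous_compose _ _ _ _ f) => //; rewrite /scale_plane; cont.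
  by rewrite /h /sqdist; cont.
pose K := ((`[-1, 1] `*` `[-1, 1]) `*` `[2^-1 : R, 1]) `&`
  (fun z : (R * R) * R => z.1.1 ^+ 2 + z.1.2 ^+ 2) @^-1` [set x | x = 1].
have cK : compact K.
  apply: compact_closedI.
    by apply: compact_setX; [apply: compact_setX|]; exact: segment_compact.
  by apply: (continuous_closedP _).1; [cont|exact: closed_eq].
have inK e s : e.1 ^+ 2 + e.2 ^+ 2 = 1 -> 2^-1 <= s <= 1 -> K (e, s).
  move=> e1 s1; have e2 : e.2 ^+ 2 + e.1 ^+ 2 = 1 by rewrite addrC.
  by split=> //; split; [split|]; rewrite /= in_itv //= ?(coord_le1 e1) ?(coord_le1 e2).
have [|[e s]] := compact_EVT_min _ cK (continuous_subspaceT ch).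
  exists ((1, 0), 1); apply: inK => /=; lra.
rewrite inE => -[[/= _]]; rewrite /= in_itv /= => s1 e1 hmin.
exists (h (e, s)) => [|e' s' h1 h2]; last first.
  by apply: (hmin (e', s')); rewrite inE; exact: inK.
apply: sqdist_gt0 => /= /injf.
have De : unit_disc e by rewrite /unit_disc e1.
rewrite !inE => H; have {H} : scale_plane s e = scale_plane (s - 1) e.
  by apply: H; apply: unit_disc_scale => //; lra.
rewrite /scale_plane => -[q1 q2].
have z1 : e.1 = 0 by lra.
have z2 : e.2 = 0 by lra.
by move: e1; rewrite z1 z2; lra.
Qed.

(** If [y] is missed, f(2x) - y has no zero on the disc of radius 1/2. The surrounding ring deforms
    it into f(e/2) - f(-e/2), which is odd. A zero in the ring would bring two images within |y -
    f(0)| of each other, below the gap. *)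
Lemma open_image (f : R * R -> R * R) : continuous f ->
  {in [set x | unit_disc x] &, injective f} ->
  exists2 m, 0 < m & forall y, `|y.1 - (f (0, 0)).1| < m ->
    `|y.2 - (f (0, 0)).2| < m -> exists2 x, unit_disc x & f x = y.
Proof.
move=> cf injf; have [m m0 gap] := antipodal_gap cf injf.
(* Two coordinates below sqrt(m)/2 give a squared distance below m/2, hence below the gap [m]. *)
exists (Num.sqrt m / 2) => [|y y1 y2]; first by rewrite divr_gt0 ?sqrtr_gt0.
apply: contrapT => noy.
pose r (x : R * R) := Num.sqrt (x.1 ^+ 2 + x.2 ^+ 2).
have cr : continuous r by rewrite /r; cont.
have r0 x : 0 <= r x by exact: sqrtr_ge0.
have r2 x : r x ^+ 2 = x.1 ^+ 2 + x.2 ^+ 2 by rewrite sqr_sqrtr// addr_ge0 ?sqr_ge0.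
(* [e x] is 2x on the half disc and x/|x| outside it; [s x] is 1 on the half disc, 3/2 - |x| on the
   ring and 1/2 beyond the unit circle. *)
pose k x := 2 / Num.max 1 (2 * r x).
pose e x := scale_plane (k x) x.
pose s x := Num.min 1 (Num.max 2^-1 (3 / 2 - r x)).
have max0 x : Num.max 1 (2 * r x) != 0.
  by rewrite gt_eqF// lt_max ltr01.
have cs : continuous s by rewrite /s; cont.
have ce : continuous e.
  by rewrite /e /scale_plane /k; cont => // x; exact: max0.
have c1 : continuous (fun x => f (scale_plane (s x) (e x))).
  by apply: (@continuous_compose _ _ _ _ f) => //; rewrite /scale_plane; cont.
have c2 : continuous (fun x => f (scale_plane (s x - 1) (e x))).
  by apply: (@continuous_compose _ _ _ _ f) => //; rewrite /scale_plane; cont.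
pose G1 x := (f (scale_plane (s x) (e x))).1 - (f (scale_plane (s x - 1) (e x))).1
  - (2 * s x - 1) * (y.1 - (f (0, 0)).1).
pose G2 x := (f (scale_plane (s x) (e x))).2 - (f (scale_plane (s x - 1) (e x))).2
  - (2 * s x - 1) * (y.2 - (f (0, 0)).2).
apply: (@no_odd_map R G1 G2).
- by rewrite /G1; cont.
- by rewrite /G2; cont.
- move=> x; apply/negPn/negP; rewrite negb_or !negbK => /andP[/eqP g1 /eqP g2].
  have [rx|rx] := leP (r x) 2^-1.
    have s1 : s x = 1.
      by rewrite /s; apply/min_idPl; rewrite le_max; apply/orP; right; lra.
    have k1 : k x = 2 by rewrite /k (max_idPl _) ?divr1//; lra.
    have De : unit_disc (e x).
      rewrite /unit_disc /e /= k1 !exprMn -mulrDr -r2 -exprMn expr_le1//; first by lra.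
      by rewrite mulr_ge0.
    apply: noy; exists (e x) => //.
    have E1 : scale_plane (s x) (e x) = e x.
      by rewrite s1 /scale_plane !mul1r -surjective_pairing.
    have E2 : scale_plane (s x - 1) (e x) = (0, 0).
      by rewrite s1 subrr /scale_plane !mul0r.
    move: g1 g2; rewrite /G1 /G2 E1 E2 s1 => g1 g2.
    by rewrite (surjective_pairing (f _)) (surjective_pairing y); congr pair; lra.
  have e1 : (e x).1 ^+ 2 + (e x).2 ^+ 2 = 1.
    rewrite /e /= !exprMn -mulrDr -r2 /k (max_idPr _); last by lra.
    by field; lra.
  have s1 : 2^-1 <= s x <= 1.
    by rewrite /s ge_min lexx /= le_min le_max lexx /= !andbT; lra.
  have := gap _ _ e1 s1.
  have -> : sqdist (f (scale_plane (s x) (e x))) (f (scale_plane (s x - 1) (e x))) =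
      (2 * s x - 1) ^+ 2 * sqdist y (f (0, 0)).
    rewrite /sqdist mulrDr -!exprMn; congr (_ ^+ 2 + _ ^+ 2).
      by apply/eqP; rewrite -subr_eq0; apply/eqP.
    by apply/eqP; rewrite -subr_eq0; apply/eqP.
  apply/negP; rewrite -ltNge.
  have sm : Num.sqrt m ^+ 2 = m by rewrite sqr_sqrtr// ltW.
  have q1 : (y.1 - (f (0, 0)).1) ^+ 2 < m / 4.
    rewrite -real_normK ?num_real// -sm -[4](_ : 2 ^+ 2 = _ :> R); last by ring.
    by rewrite -expr_div_n ltr_pXn2r// nnegrE ?normr_ge0// divr_ge0 ?sqrtr_ge0.
  have q2 : (y.2 - (f (0, 0)).2) ^+ 2 < m / 4.
    rewrite -real_normK ?num_real// -sm -[4](_ : 2 ^+ 2 = _ :> R); last by ring.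
    by rewrite -expr_div_n ltr_pXn2r// nnegrE ?normr_ge0// divr_ge0 ?sqrtr_ge0.
  apply: (@le_lt_trans _ _ (sqdist y (f (0, 0)))); last by rewrite /sqdist; lra.
  rewrite ler_piMl ?addr_ge0 ?sqr_ge0// expr_le1//; lra.
- move=> x x1.
  have rE z : z.1 ^+ 2 + z.2 ^+ 2 = 1 -> r z = 1 by move=> h; rewrite /r h sqrtr1.
  have sE z : r z = 1 -> s z = 2^-1.
    move=> h; rewrite /s h (max_idPl _); last by lra.
    by rewrite (min_idPr _)//; lra.
  have eE z : r z = 1 -> e z = z.
    move=> h; rewrite /e /k h (max_idPr _); last by lra.
    by rewrite mulr1 divff ?pnatr_eq0// /scale_plane !mul1r -surjective_pairing.
  have r1 := rE _ x1.
  have r1' : r (opp_plane x) = 1 by apply: rE; rewrite /= !sqrrN.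
  have h1 : scale_plane (2^-1) (opp_plane x) = scale_plane (2^-1 - 1) x.
    by rewrite /scale_plane /=; congr pair; field.
  have h2 : scale_plane (2^-1 - 1) (opp_plane x) = scale_plane 2^-1 x.
    by rewrite /scale_plane /=; congr pair; field.
  rewrite /G1 /G2 !sE// !eE// h1 h2 divff ?pnatr_eq0// subrr !mul0r !subr0.
  by rewrite !opprB.
Qed.

End OpenImage.

(** * Planar charts of a sphere *)

Section Chart.
Context {R : realType}.

Local Notation i0 := (ord0 : 'I_3).
Local Notation i1 := (lift ord0 ord0 : 'I_3).
Local Notation i2 := (lift ord0 (lift ord0 ord0) : 'I_3).

Definition row3 (a b c : R) : 'rV[R]_3 :=
  \row_i (if i == i0 then a else if i == i1 then b else c).

Lemma row3P (y : 'rV[R]_3) : y = row3 (y ord0 i0) (y ord0 i1) (y ord0 i2).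
Proof.
apply/rowP => i; rewrite mxE; case: (unliftP ord0 i) => [j|] -> //=.
case: (unliftP ord0 j) => [k|] -> //=.
by rewrite (ord1 k).
Qed.

Lemma row3E a b c : ((row3 a b c ord0 i0 = a) * (row3 a b c ord0 i1 = b) *
  (row3 a b c ord0 i2 = c))%type.
Proof. by rewrite !mxE. Qed.

Lemma continuous_row3 (T : topologicalType) (a b c : T -> R) :
  continuous a -> continuous b -> continuous c ->
  continuous (fun t => row3 (a t) (b t) (c t)).
Proof.
move=> ca cb cc; apply: continuous_row => i.
by case: (i == i0) => //; case: (i == i1).
Qed.

Lemma unit_sphere3E (y : 'rV[R]_3) : unit_sphere R 3 y <->
  y ord0 i0 ^+ 2 + y ord0 i1 ^+ 2 + y ord0 i2 ^+ 2 = 1.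
Proof.
by rewrite /unit_sphere /= !big_ord_recl big_ord0 addr0 !addrA.
Qed.

(* The reflection exchanging [z] and the north pole; it is the identity when
   [z] is the north pole, since then the denominator vanishes and [0^-1 = 0]. *)
Definition householder (z y : 'rV[R]_3) : 'rV[R]_3 :=
  let v0 := z ord0 i0 in let v1 := z ord0 i1 in let v2 := z ord0 i2 - 1 in
  let c := 2 * (y ord0 i0 * v0 + y ord0 i1 * v1 + y ord0 i2 * v2) /
    (v0 ^+ 2 + v1 ^+ 2 + v2 ^+ 2) in
  row3 (y ord0 i0 - c * v0) (y ord0 i1 - c * v1) (y ord0 i2 - c * v2).

Lemma householderK z : involutive (householder z).
Proof.
move=> y; rewrite [RHS]row3P /householder !row3E.
set v0 := z ord0 i0; set v1 := z ord0 i1; set v2 := z ord0 i2 - 1.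
have [->|d0] := eqVneq (v0 ^+ 2 + v1 ^+ 2 + v2 ^+ 2) 0.
  by rewrite invr0 !mulr0 !mul0r !subr0.
by congr row3; field.
Qed.

Lemma householder_sphere z y : unit_sphere R 3 y -> unit_sphere R 3 (householder z y).
Proof.
rewrite !unit_sphere3E /householder !row3E => y1; rewrite -[RHS]y1 {y1}.
set v0 := z ord0 i0; set v1 := z ord0 i1; set v2 := z ord0 i2 - 1.
have [->|d0] := eqVneq (v0 ^+ 2 + v1 ^+ 2 + v2 ^+ 2) 0.
  by rewrite invr0 !mulr0 !mul0r !subr0.
by field.
Qed.

Lemma householder_pole z : unit_sphere R 3 z -> householder z z = row3 0 0 1.
Proof.
rewrite unit_sphere3E /householder => z1.
have [d0|d0] := eqVneq (z ord0 i0 ^+ 2 + z ord0 i1 ^+ 2 + (z ord0 i2 - 1) ^+ 2) 0.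
  have zz : 1 - z ord0 i2 = 0 by lra.
  have := sqr_ge0 (z ord0 i0); have := sqr_ge0 (z ord0 i1) => a b.
  have z2 : z ord0 i2 = 1 by lra.
  move: d0; rewrite z2 subrr expr0n addr0 => d0.
  have /eqP : z ord0 i0 ^+ 2 = 0 by lra.
  have /eqP : z ord0 i1 ^+ 2 = 0 by lra.
  rewrite !sqrf_eq0 => /eqP -> /eqP ->.
  by rewrite !mul0r !mulr0 !subr0.
have c1 : 2 * (z ord0 i0 * z ord0 i0 + z ord0 i1 * z ord0 i1 + z ord0 i2 * (z ord0 i2 - 1)) /
    (z ord0 i0 ^+ 2 + z ord0 i1 ^+ 2 + (z ord0 i2 - 1) ^+ 2) = 1.
  by apply: (canLR (mulfK d0)); rewrite mul1r; lra.
by rewrite c1 !mul1r !subrr opprB addrC subrK.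
Qed.

Lemma continuous_householder (T : topologicalType) z (f : T -> 'rV[R]_3) :
  continuous f -> continuous (fun t => householder z (f t)).
Proof.
by move=> cf; apply: continuous_row3; cont.
Qed.

Definition stereo (y : 'rV[R]_3) : R * R :=
  (y ord0 i0 / (1 - y ord0 i2), y ord0 i1 / (1 - y ord0 i2)).

Definition unstereo (x : R * R) : 'rV[R]_3 :=
  let d := x.1 ^+ 2 + x.2 ^+ 2 + 1 in
  row3 (2 * x.1 / d) (2 * x.2 / d) ((d - 2) / d).

Lemma stereo_den (x : R * R) : x.1 ^+ 2 + x.2 ^+ 2 + 1 != 0.
Proof.
by rewrite gt_eqF//; have := sqr_ge0 x.1; have := sqr_ge0 x.2; lra.
Qed.

Lemma continuous_unstereo : continuous unstereo.
Proof.
by apply: continuous_row3; cont => x; exact: stereo_den.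
Qed.

Lemma unstereo_sphere x : unit_sphere R 3 (unstereo x).
Proof.
rewrite unit_sphere3E /unstereo !row3E; have := stereo_den x.
by move: x.1 x.2 => a b d; field.
Qed.

Lemma unstereo_neq x : unstereo x ord0 i2 != 1.
Proof.
rewrite /unstereo !row3E; apply/eqP => h.
have := stereo_den x; move: h; set d := _ + 1 => h d0.
have {}h : d - 2 = d by rewrite -[LHS](mulfVK d0) h mul1r.
have /eqP : (2 : R) = 0 by lra.
by rewrite pnatr_eq0.
Qed.

Lemma unstereoK : cancel unstereo stereo.
Proof.
move=> [a b]; rewrite /stereo /unstereo !row3E /=.
have := stereo_den (a, b); rewrite /=; set d := _ + 1 => d0.
have -> : 1 - (d - 2) / d = 2 / d by field.
by congr pair; field.
Qed.

Lemma stereoK y : unit_sphere R 3 y -> y ord0 i2 != 1 -> unstereo (stereo y) = y.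
Proof.
rewrite unit_sphere3E => y1 y2; rewrite [RHS]row3P /unstereo /stereo /=.
set a := y ord0 i0 in y1 *; set b := y ord0 i1 in y1 *; set c := y ord0 i2 in y1 y2 *.
have c0 : 1 - c != 0 by rewrite subr_eq0 eq_sym.
have E : (a / (1 - c)) ^+ 2 + (b / (1 - c)) ^+ 2 + 1 = 2 / (1 - c).
  rewrite !expr_div_n -mulrDl (_ : a ^+ 2 + b ^+ 2 = 1 - c ^+ 2); last by lra.
  by field.
by rewrite E; congr row3; field.
Qed.

(** The image of [p] is reflected to the north pole and stereographic projection follows. [F]
    carries no information at [p] or off [A], so its continuity is stated after composition with
    maps that stay in [A] and avoid [p]. *)
Lemma planar_chart (X : topologicalType) (A : set X) (p : X) :
  homeomorphic A (unit_sphere R 3) -> A p ->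
  exists (F : X -> R * R) (G : R * R -> X),
    [/\ continuous G, forall z, A (G z) /\ G z <> p, cancel G F,
        forall x, A x -> x <> p -> G (F x) = x
      & forall (T : topologicalType) (h : T -> X), continuous h ->
        (forall t, A (h t) /\ h t <> p) -> continuous (fun t => F (h t))].
Proof.
move=> [f [g [[cf cg] [fA gB] fK gK]]] Ap.
have Sf x : A x -> unit_sphere R 3 (f x) by move=> Ax; apply: fA; exists x.
have Ag y : unit_sphere R 3 y -> A (g y) by move=> Sy; apply: gB; exists y.
have fgK y : unit_sphere R 3 y -> f (g y) = y by move=> Sy; apply: gK; rewrite inE.
have gfK x : A x -> g (f x) = x by move=> Ax; apply: fK; rewrite inE.
pose H := householder (f p).
have Su z : unit_sphere R 3 (H (unstereo z)).
  by apply: householder_sphere; exact: unstereo_sphere.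
have Hne x : A x -> x <> p -> H (f x) ord0 i2 != 1.
  move=> Ax xp; apply/eqP => h; apply: xp.
  have := householder_sphere (f p) (Sf _ Ax); rewrite unit_sphere3E -/H h expr1n => s.
  have := sqr_ge0 (H (f x) ord0 i0); have := sqr_ge0 (H (f x) ord0 i1) => q1 q2.
  have /eqP : H (f x) ord0 i0 ^+ 2 = 0 by lra.
  have /eqP : H (f x) ord0 i1 ^+ 2 = 0 by lra.
  rewrite !sqrf_eq0 => /eqP r1 /eqP r0.
  have : H (f x) = H (f p).
    by rewrite /H householder_pole; [rewrite [LHS]row3P -/H r0 r1 h|exact: Sf].
  move=> /(inv_inj (householderK (f p))) e.
  by rewrite -(gfK _ Ax) e gfK.
exists (fun x => stereo (H (f x))), (fun z => g (H (unstereo z))); split.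
- apply: (continuous_within_comp cg) => //.
  by apply: continuous_householder; exact: continuous_unstereo.
- move=> z; split; first exact: Ag.
  move=> /(congr1 f); rewrite fgK// => /(congr1 H).
  rewrite /H householderK householder_pole; last exact: Sf.
  by move=> e; have := unstereo_neq z; rewrite e row3E eqxx.
- by move=> z; rewrite fgK// /H householderK unstereoK.
- move=> x Ax xp; rewrite stereoK ?Hne//; last by apply: householder_sphere; exact: Sf.
  by rewrite /H householderK gfK.
- move=> T h ch Ah; rewrite /stereo.
  have cH : continuous (fun t => H (f (h t))).
    apply: continuous_householder; apply: (continuous_within_comp cf) => // t.
    by have [] := Ah t.
  have cI : continuous (fun t => (1 - H (f (h t)) ord0 i2)^-1).
    apply: continuous_inv; last by cont.
    by move=> t; rewrite subr_eq0 eq_sym; have [a b] := Ah t; exact: Hne.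
  by cont.
Qed.

End Chart.

(** * Local structure of a flag sphere *)

Section LocalStructure.
Context {R : realType} {n : nat} (G : sgraph n).

Lemma adjacent_sym : symmetric (adjacent G).
Proof. by move=> x y; rewrite /adjacent finset.setUC. Qed.

Lemma adjacent_irr x : adjacent G x x = false.
Proof.
apply/negP; rewrite /adjacent finset.setUid => h.
have /forallP/(_ [set x]%SET)/implyP/(_ h) := edgesP G.
by rewrite cards1.
Qed.

Lemma adjacent_neq x y : adjacent G x y -> x != y.
Proof. by apply: contraTneq => ->; rewrite adjacent_irr. Qed.

Local Notation X := (realization R (clique_complex G)).

Lemma realizationP (x : 'rV[R]_n) : X x <->
  [/\ forall i, 0 <= x ord0 i, \sum_i x ord0 i = 1 &
      forall i j, i != j -> x ord0 i != 0 -> x ord0 j != 0 -> adjacent G i j].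
Proof.
split=> -[x0 x1 xK]; split=> //.
  move=> i j ij xi xj; move: xK; rewrite inE.
  move=> /forallP/(_ i); rewrite inE xi /= => /forallP/(_ j).
  by rewrite inE xj ij.
rewrite inE; apply/forallP => i; apply/implyP; rewrite inE => xi.
apply/forallP => j; apply/implyP; rewrite inE => xj.
by apply/implyP => ij; exact: xK.
Qed.

Lemma eq_row0 (x y : 'rV[R]_n) : (forall i, x ord0 i = y ord0 i) -> x = y.
Proof. by move=> xy; apply/rowP. Qed.

Definition vert (i : 'I_n) : 'rV[R]_n := delta_mx ord0 i.

Lemma vertE i j : vert i ord0 j = (j == i)%:R.
Proof. by rewrite mxE. Qed.

Lemma sum_vert i : \sum_j vert i ord0 j = 1.
Proof.
rewrite (bigD1 i)//= vertE eqxx big1 ?addr0// => j /negbTE ji.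
by rewrite vertE ji.
Qed.

Lemma vert_realization i : X (vert i).
Proof.
apply/realizationP; split=> [j||j k]; rewrite ?sum_vert// ?vertE ?ler0n//.
by rewrite !pnatr_eq0 !eqb0 !negbK => /eqP jk /eqP ji /eqP ki; case: jk; rewrite ji ki.
Qed.

Lemma vert_inj : injective vert.
Proof.
move=> i j /(congr1 (fun x : 'rV[R]_n => x ord0 i)); rewrite !vertE eqxx.
by case: eqP => // _ /eqP; rewrite oner_eq0.
Qed.

Lemma continuous_rowZ (T : topologicalType) (c : T -> R) (f : T -> 'rV[R]_n) :
  continuous c -> continuous f -> continuous (fun t => c t *: f t).
Proof. by move=> cc cf t; apply: cvgZ; [exact: cc|exact: cf]. Qed.

Lemma continuous_rowD (T : topologicalType) (f g : T -> 'rV[R]_n) :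
  continuous f -> continuous g -> continuous (fun t => f t + g t).
Proof. by move=> cf cg t; apply: cvgD; [exact: cf|exact: cg]. Qed.

Lemma near_disc (h : R * R -> R) z : continuous h -> 0 < h z ->
  exists2 e, 0 < e & forall v, unit_disc v -> 0 < h (z.1 + e * v.1, z.2 + e * v.2).
Proof.
move=> ch hz.
have : \forall y \near z, 0 < h y by exact: (cvgr_gt _ (ch z) _ hz).
move=> /nbhs_ballP [e /= e0 He]; exists (e / 2); first by rewrite divr_gt0.
have bnd a b : a ^+ 2 + b ^+ 2 <= 1 -> `|e / 2 * a| < e.
  move=> ab; have a1 : `|a| <= 1.
    rewrite -(ler_pXn2r (ltn0Sn 1)) ?nnegrE// expr1n real_normK ?num_real//.
    by have := sqr_ge0 b; lra.
  by rewrite normrM ger0_norm; nra.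
move=> v v1; apply: He; split; rewrite /ball /= opprD addNKr normrN.
  exact: (bnd _ _ v1).
by apply: (bnd _ v.1); rewrite addrC.
Qed.

(** One-dimensional Borsuk-Ulam: on a small circle around [p], in the chart that removes [p'], [u]
    agrees at two opposite points. The function [m] is a cutoff whose positivity marks the
    neighbourhood of [p] where [u] is injective. *)
Lemma sphere_not_locally_linear (p p' : 'rV[R]_n) (u m : 'rV[R]_n -> R) :
  homeomorphic X (unit_sphere R 3) -> X p -> X p' -> p <> p' ->
  continuous u -> continuous m -> 0 < m p ->
  (forall x y, X x -> X y -> 0 < m x -> 0 < m y -> u x = u y -> x = y) -> False.
Proof.
move=> hom Xp Xp' pp' cu cm mp inj.
have [F [H [cH XH HK FK _]]] := planar_chart hom Xp'.
have Hp : H (F p) = p by exact: FK.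
have cmH : continuous (fun z => m (H z)).
  exact: (@continuous_compose _ _ _ H m).
have [|e e0 He] := near_disc (z := F p) cmH; first by rewrite Hp.
pose pt s t := ((F p).1 + e * (s * cos t), (F p).2 + e * (s * sin t)).
have cpt s : continuous (fun t => u (H (pt s t))).
  apply: (@continuous_compose _ _ _ (fun t => H (pt s t)) u) => //.
  apply: (@continuous_compose _ _ _ (pt s) H) => //.
  by rewrite /pt; cont; [exact: continuous_cos|exact: continuous_sin].
pose k t := u (H (pt 1 t)) - u (H (pt (-1) t)).
have ck : continuous k by rewrite /k; cont; exact: cpt.
have kpi : k pi = - k 0.
  have h s : pt s pi = pt (- s) 0.
    by rewrite /pt cospi sinpi cos0 sin0; congr pair; ring.
  by rewrite /k !h opprK opprB.
have mpt s t : s = 1 \/ s = -1 -> 0 < m (H (pt s t)).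
  move=> s1; apply: (He (s * cos t, s * sin t)).
  by rewrite /unit_disc /= !exprMn -mulrDr cos2Dsin2; case: s1 => ->; rewrite ?sqrrN ?expr1n mulr1.
suff : 0 < k 0 * k pi by rewrite kpi mulrN oppr_gt0 -expr2 ltNge sqr_ge0.
apply: ivt_same_sign => // [|t _]; first exact: pi_ge0.
apply/eqP => /eqP; rewrite subr_eq0 => /eqP uu.
have := inj _ _ (XH (pt 1 t)).1 (XH (pt (-1) t)).1 (mpt _ _ _) (mpt _ _ _) uu.
move=> /(_ (or_introl erefl) (or_intror erefl)) /(can_inj HK) [q1 q2].
have c0 : cos t = 0 by apply: (mulfI (lt0r_neq0 e0)); lra.
have s0 : sin t = 0 by apply: (mulfI (lt0r_neq0 e0)); lra.
by have /eqP := cos2Dsin2 t; rewrite c0 s0 expr0n addr0 eq_sym oner_eq0.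
Qed.

(** Without neighbours, [vert a] would be an isolated point of the sphere. The vertex [v] supplies
    the point to remove. *)
Lemma no_isolated_vertex (a v : 'I_n) :
  homeomorphic X (unit_sphere R 3) -> a != v -> exists b, adjacent G a b.
Proof.
move=> hom av; apply: contrapT => noa.
have E x : X x -> 0 < x ord0 a -> x = vert a.
  move=> /realizationP [x0 x1 xK] xa.
  have xz i : i != a -> x ord0 i = 0.
    move=> ia; apply/eqP; apply: contrapT => /negP xi; apply: noa; exists i.
    by apply: xK => //; [rewrite eq_sym|rewrite gt_eqF].
  apply: eq_row0 => i; rewrite vertE; case: eqP => [->|/eqP/xz//].
  by rewrite -x1 (bigD1 a)//= big1 ?addr0// => j /xz.
apply: (@sphere_not_locally_linear (vert a) (vert v) (fun x => x ord0 a)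
  (fun x => x ord0 a) hom) => //; try exact: vert_realization; try exact: coord_continuous.
- by move/vert_inj/eqP; rewrite (negbTE av).
- by rewrite vertE eqxx.
- by move=> x y Xx Xy xa ya _; rewrite (E x)// (E y).
Qed.

Definition common_neighbour (a b c : 'I_n) := adjacent G a c && adjacent G b c.

(* Unification otherwise unfolds [adjacent G x y] into finite set computations
   when comparing it with [adjacent G y x]. *)
#[local] Opaque adjacent.

(** The reflexive closure of adjacency lets [clique4] and [comb] treat edges and triangles as
    tetrahedra with repeated vertices. *)
Definition wadj x y := (x == y) || adjacent G x y.

Lemma wadj_sym x y : wadj x y = wadj y x.
Proof. by rewrite /wadj eq_sym adjacent_sym. Qed.

Lemma clique4 a b c d : wadj a b -> wadj a c -> wadj a d -> wadj b c ->
  wadj b d -> wadj c d -> clique G [set a; b; c; d]%SET.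
Proof.
move=> ab ac ad bc bd cd; rewrite /clique; apply/forallP => x; apply/implyP => xC.
apply/forallP => y; apply/implyP => yC; apply/implyP => xy.
suff : wadj x y by rewrite /wadj (negbTE xy).
move: xC yC; rewrite !inE -!orbA => /or4P[] /eqP -> /or4P[] /eqP -> //.
all: by [rewrite /wadj eqxx | rewrite wadj_sym].
Qed.

Definition comb (A B C D : R) (a b c d : 'I_n) : 'rV[R]_n :=
  A *: vert a + B *: vert b + C *: vert c + D *: vert d.

Lemma combE A B C D a b c d i : comb A B C D a b c d ord0 i =
  A * (i == a)%:R + B * (i == b)%:R + C * (i == c)%:R + D * (i == d)%:R.
Proof. by rewrite !mxE. Qed.

Lemma sum_comb A B C D a b c d :
  \sum_i comb A B C D a b c d ord0 i = A + B + C + D.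
Proof.
have S k (t : R) : \sum_(i < n) (t * (i == k)%:R) = t.
  rewrite -mulr_sumr (eq_bigr (fun i => vert k ord0 i)) ?sum_vert ?mulr1// => i _.
  by rewrite vertE.
under eq_bigr do rewrite combE.
by rewrite !big_split /= !S.
Qed.

Lemma comb_realization A B C D a b c d : clique G [set a; b; c; d]%SET ->
  0 <= A -> 0 <= B -> 0 <= C -> 0 <= D -> A + B + C + D = 1 ->
  X (comb A B C D a b c d).
Proof.
move=> K A0 B0 C0 D0 s1; apply/realizationP; split=> [i||i j ij].
- by rewrite combE !addr_ge0// mulr_ge0.
- by rewrite sum_comb.
have H k : comb A B C D a b c d ord0 k != 0 -> k \in [set a; b; c; d]%SET.
  rewrite combE !inE; apply: contraNT; rewrite !negb_or -!andbA.
  by move=> /and4P[/negbTE -> /negbTE -> /negbTE -> /negbTE ->]; rewrite !mulr0 !addr0.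
move=> /H iC /H jC; move: K; rewrite /clique => /forallP /(_ i); rewrite iC => /forallP/(_ j).
by rewrite jC ij.
Qed.

Definition midpoint (a b : 'I_n) : 'rV[R]_n := comb 2^-1 2^-1 0 0 a b a b.

Lemma midpoint_realization a b : adjacent G a b -> X (midpoint a b).
Proof.
move=> ab; apply: comb_realization; rewrite ?invr_ge0 ?ler0n//; last by lra.
by apply: clique4; rewrite /wadj ?eqxx ?[adjacent G b a]adjacent_sym ?ab ?orbT.
Qed.

(** The positivity hypotheses place [x] in the open star of the edge [ab], a neighbourhood of its
    midpoint. *)
Lemma near_edge_support a b x i : X x -> 0 < x ord0 a -> 0 < x ord0 b ->
  x ord0 i != 0 -> [|| i == a, i == b | common_neighbour a b i].
Proof.
move=> /realizationP [x0 x1 xK] xa xb xi; rewrite /common_neighbour.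
case: eqP => //= /eqP ia; case: eqP => //= /eqP ib.
have xa0 : x ord0 a != 0 by rewrite gt_eqF.
have xb0 : x ord0 b != 0 by rewrite gt_eqF.
by rewrite eq_sym in ia; rewrite eq_sym in ib; rewrite !xK.
Qed.

(** An edge in no triangle is its own open star, and the coordinate at [a] is injective on it. *)
Lemma edge_in_triangle a b : homeomorphic X (unit_sphere R 3) -> adjacent G a b ->
  exists c, common_neighbour a b c.
Proof.
move=> hom ab; apply: contrapT => noc; have abn := adjacent_neq ab.
have E x : X x -> 0 < x ord0 a -> 0 < x ord0 b ->
    x = comb (x ord0 a) (1 - x ord0 a) 0 0 a b a b.
  move=> Xx xa xb; have [x0 x1 _] := (realizationP x).1 Xx.
  have xz i : i != a -> i != b -> x ord0 i = 0.
    move=> ia ib; apply/eqP; apply: contrapT => /negP /(near_edge_support Xx xa xb).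
    by rewrite (negbTE ia) (negbTE ib) /= => ci; apply: noc; exists i.
  have xab : 1 = x ord0 a + x ord0 b.
    rewrite -x1 (bigD1 a)//= (bigD1 b) 1?eq_sym//= big1 ?addr0// => j /andP[h1 h2].
    exact: xz.
  apply: eq_row0 => i; rewrite combE !mul0r !addr0.
  case: (i =P a) => [->|/eqP ia]; first by rewrite (negbTE abn) /=; ring.
  case: (i =P b) => [->|/eqP ib]; last by rewrite xz//=; ring.
  by move: xab => /=; lra.
have mE x : 0 < Num.min (x ord0 a) (x ord0 b) -> 0 < x ord0 a /\ 0 < x ord0 b :> R.
  by rewrite lt_min => /andP.
apply: (@sphere_not_locally_linear (midpoint a b) (vert a)
  (fun x : 'rV[R]_n => x ord0 a)
  (fun x : 'rV[R]_n => Num.min (x ord0 a) (x ord0 b)) hom).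
- exact: midpoint_realization.
- exact: vert_realization.
- move/(congr1 (fun x : 'rV[R]_n => x ord0 b)); rewrite combE vertE.
  by rewrite eqxx eq_sym (negbTE abn) /=; lra.
- by cont.
- by cont.
- rewrite lt_min !combE !eqxx (negbTE abn) eq_sym (negbTE abn) /=; apply/andP; lra.
- move=> x y Xx Xy /mE[xa xb] /mE[ya yb] xy.
  by rewrite (E x)// (E y)// xy.
Qed.

End LocalStructure.

(** * At least two triangles at every edge *)

Section EdgeLinks.
Context {R : realType} {n : nat} (G : sgraph n).

Local Notation X := (realization R (clique_complex G)).
Implicit Types a b c d : 'I_n.

Lemma common_neighbour_neq a b c : common_neighbour G a b c -> (a != c) * (b != c).
Proof. by move=> /andP[/adjacent_neq -> /adjacent_neq ->]. Qed.

Lemma triangle_clique a b c : adjacent G a b -> common_neighbour G a b c ->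
  clique G [set a; b; c; c]%SET.
Proof.
move=> ab /andP[ac bc].
by apply: clique4; rewrite /wadj ?ab ?ac ?bc ?eqxx ?orbT.
Qed.

(** If [c] were the only common neighbour, the open star of [ab] would be a half-disc with the
    midpoint [m] on its straight side. A circle around F(m) in the chart would then extend to a map
    [g] of the plane avoiding [m], and F(g) - F(m) would be nowhere zero and odd on the unit
    circle. *)
Lemma edge_in_two_triangles a b c : homeomorphic X (unit_sphere R 3) ->
  adjacent G a b -> common_neighbour G a b c ->
  exists2 d, d != c & common_neighbour G a b d.
Proof.
move=> hom ab abc; apply: contrapT => nod.
have abn := adjacent_neq ab; have [acn bcn] := common_neighbour_neq abc.
have [F [H [cH XH HK FK cF]]] := planar_chart hom (vert_realization (R := R) G a).
pose m := midpoint (R := R) a b.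
have Xm : X m by exact: midpoint_realization.
have ma : m ord0 a = 2^-1.
  by rewrite combE eqxx (negbTE abn) /=; ring.
have mb : m ord0 b = 2^-1.
  by rewrite combE eqxx eq_sym (negbTE abn) /=; ring.
have mc : m ord0 c = 0.
  by rewrite combE ![c == _]eq_sym (negbTE acn) (negbTE bcn) /=; ring.
have mv : m <> vert a.
  by move/(congr1 (fun x : 'rV[R]_n => x ord0 b)); rewrite mb vertE eq_sym (negbTE abn) /=; lra.
have HF : H (F m) = m by exact: FK.
have cHmin : continuous (fun z => Num.min (H z ord0 a) (H z ord0 b)) by cont.
have [|e e0 He] := near_disc (z := F m) cHmin; first by rewrite HF ma mb minxx invr_gt0 ltr0n.
(* The triangle [abc] without [m] is star-shaped around [q]: contract a small
   circle around [m] to [q]. *)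
pose q := comb 3^-1 3^-1 3^-1 0 a b c c : 'rV[R]_n.
pose r (v : R * R) := Num.sqrt (v.1 ^+ 2 + v.2 ^+ 2).
have r0 v : 0 <= r v by exact: sqrtr_ge0.
have r2 v : r v ^+ 2 = v.1 ^+ 2 + v.2 ^+ 2 by rewrite sqr_sqrtr// addr_ge0 ?sqr_ge0.
(* [k] retracts the plane radially onto the unit disc, where [y] is defined through the chart; [g]
   equals [q] at the origin and [y] from the unit circle outwards. *)
pose k v := (Num.max 1 (r v))^-1.
pose s v := Num.min 1 (r v).
pose y v := H ((F m).1 + e * (k v * v.1), (F m).2 + e * (k v * v.2)).
pose g v := (1 - s v) *: q + s v *: y v.
have cr : continuous r by rewrite /r; cont.
have cg : continuous g.
  have cy : continuous y.
    apply: (@continuous_compose _ _ _ _ H) => //; rewrite /k; cont => v.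
      by rewrite gt_eqF// lt_max ltr01.
    by rewrite gt_eqF// lt_max ltr01.
  apply: continuous_rowD; apply: continuous_rowZ => //; rewrite /s; cont.
have kD v : unit_disc (k v * v.1, k v * v.2).
  rewrite /unit_disc /= !exprMn -mulrDr -r2 -exprMn expr_le1// /k.
    by rewrite mulrC ler_pdivrMr ?mul1r ?le_max ?lexx ?orbT// lt_max ltr01.
  by rewrite mulr_ge0// invr_ge0 le_max ler01.
have yab v : 0 < y v ord0 a /\ 0 < y v ord0 b.
  by have := He _ (kD v); rewrite lt_min => /andP.
have Xy v : X (y v) by have [] := XH ((F m).1 + e * (k v * v.1), (F m).2 + e * (k v * v.2)).
have y0 v i : 0 <= y v ord0 i by have [h _ _] := (realizationP _ (y v)).1 (Xy v).
have ysupp v i : y v ord0 i != 0 -> i \in [set a; b; c; c]%SET.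
  have [ya yb] := yab v; move=> /(near_edge_support (Xy v) ya yb).
  rewrite !inE => /or3P[->|->|abi]; rewrite ?orbT//.
  have [->|ic] := eqVneq i c; first by rewrite ?eqxx ?orbT.
  by exfalso; apply: nod; exists i.
have s01 v : 0 <= s v <= 1 by rewrite ge_min lexx /= le_min ler01 r0.
have gE v i : g v ord0 i = (1 - s v) * q ord0 i + s v * y v ord0 i by rewrite !mxE.
have q0 i : 0 <= q ord0 i.
  by rewrite combE; do ! case: (_ == _) => /=; lra.
have Xg v : X (g v).
  have [s0 s1] := andP (s01 v).
  apply/realizationP; split=> [i||i j ij].
  - by rewrite gE addr_ge0// mulr_ge0// subr_ge0.
  - under eq_bigr do rewrite gE.
    rewrite big_split /= -!mulr_sumr sum_comb.
    have [_ -> _] := (realizationP _ (y v)).1 (Xy v).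
    by lra.
  have sup l : g v ord0 l != 0 -> l \in [set a; b; c; c]%SET.
    apply: contraNT => lK; have yl : y v ord0 l = 0.
      by apply/eqP; apply: contraNT lK; exact: ysupp.
    rewrite gE yl combE; move: lK; rewrite !inE !negb_or -!andbA.
    by move=> /and4P[/negbTE -> /negbTE -> /negbTE -> _] /=; apply/eqP; ring.
  move=> /sup iK /sup jK; have := triangle_clique ab abc.
  by rewrite /clique => /forallP/(_ i); rewrite iK => /forallP/(_ j); rewrite jK ij.
have gb v : 0 < g v ord0 b.
  have [s0 s1] := andP (s01 v); have [_ yb] := yab v.
  have qb : q ord0 b = 3^-1 by rewrite combE eqxx eq_sym (negbTE abn) (negbTE bcn) /=; ring.
  by rewrite gE qb; nra.
have gv v : g v <> vert a.
  move/(congr1 (fun x : 'rV[R]_n => x ord0 b)); rewrite vertE eq_sym (negbTE abn) /= => h.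
  by have := gb v; rewrite h ltxx.
(* Inside the unit circle the weight of [q] makes the coordinate at [c] positive, while it is 0 at
   [m]. From the circle outwards [g] is [y], which the chart separates from [m]. *)
have gm v : g v <> m.
  have [s1|s1] := ltP (s v) 1.
    move/(congr1 (fun x : 'rV[R]_n => x ord0 c)); rewrite mc gE.
    have -> : q ord0 c = 3^-1.
      by rewrite combE eqxx ![c == _]eq_sym (negbTE acn) (negbTE bcn) /=; ring.
    have [s0 _] := andP (s01 v); have := y0 v c.
    by move=> h1 h2; have : 0 <= s v * y v ord0 c by [exact: mulr_ge0]; lra.
  have sv : s v = 1 by apply/eqP; rewrite eq_le s1 (andP (s01 v)).2.
  have rv : 1 <= r v by move: s1; rewrite /s le_min => /andP[].
  rewrite /g sv subrr scale0r add0r scale1r => ym.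
  have /eqP := congr1 F ym; rewrite /y HK => /eqP.
  rewrite [RHS]surjective_pairing => -[h1 h2].
  have kv : k v != 0 by rewrite invr_eq0 gt_eqF// lt_max ltr01.
  have v1 : v.1 = 0 by apply: (mulfI kv); apply: (mulfI (lt0r_neq0 e0)); lra.
  have v2 : v.2 = 0 by apply: (mulfI kv); apply: (mulfI (lt0r_neq0 e0)); lra.
  by move: (r2 v); rewrite v1 v2 expr0n /=; nra.
have cFg : continuous (fun v => F (g v)) by apply: cF.
apply: (@no_odd_map R (fun v => (F (g v)).1 - (F m).1) (fun v => (F (g v)).2 - (F m).2)).
- by cont.
- by cont.
- move=> v; rewrite !subr_eq0; apply/negPn/negP; rewrite negb_or !negbK.
  move=> /andP[/eqP h1 /eqP h2]; apply: (gm v).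
  rewrite -(FK (g v))// -(FK m)//; congr H.
  by rewrite (surjective_pairing (F (g v))) (surjective_pairing (F m)) h1 h2.
- move=> v v1.
  have E w : w.1 ^+ 2 + w.2 ^+ 2 = 1 -> F (g w) = ((F m).1 + e * w.1, (F m).2 + e * w.2).
    move=> w1; have rw : r w = 1 by rewrite /r w1 sqrtr1.
    by rewrite /g /s /y /k rw minxx maxxx invr1 subrr scale0r add0r scale1r !mul1r HK.
  rewrite !E//=; last by rewrite !sqrrN.
  by split; ring.
Qed.

End EdgeLinks.

(** * At most two triangles at every edge, and no 4-clique *)

Section EdgeLinkUpper.
Context {R : realType} {n : nat} (G : sgraph n).

Local Notation X := (realization R (clique_complex G)).
Implicit Types a b c d : 'I_n.

Lemma lerp_coord (s t : R) (x y : 'rV[R]_n) i :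
  (s *: x + t *: y) ord0 i = s * x ord0 i + t * y ord0 i.
Proof. by rewrite !mxE. Qed.

(** The triangles [abc] and [abd] glued along [ab] form a disc, which by [open_image] covers a
    neighbourhood of the midpoint. A segment of the complex from the midpoint to [q] must therefore
    start in these two pages. The midpoint has no weight off [a] and [b], so the restriction on the
    support passes to [q], which is also the point removed for the chart. *)
Lemma two_pages_open a b c d (q : 'rV[R]_n) : homeomorphic X (unit_sphere R 3) ->
  adjacent G a b -> common_neighbour G a b c -> common_neighbour G a b d ->
  c != d -> X q ->
  (forall t, 0 <= t <= 1 -> X ((1 - t) *: midpoint a b + t *: q)) ->
  (forall i, i \notin [set a; b; c; d]%SET -> q ord0 i = 0) /\
  (q ord0 c = 0 \/ q ord0 d = 0).
Proof.
move=> hom ab abc abd cd Xq Xpath; apply: contrapT => bad.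
have abn := adjacent_neq ab.
have [acn bcn] := common_neighbour_neq abc; have [adn bdn] := common_neighbour_neq abd.
pose m := midpoint (R := R) a b.
have mE i : i != a -> i != b -> m ord0 i = 0.
  by move=> /negbTE ia /negbTE ib; rewrite combE ia ib /=; ring.
have good (x : 'rV[R]_n) t : 0 < t ->
    (forall i, i \notin [set a; b; c; d]%SET -> x ord0 i = 0) ->
    (x ord0 c = 0 \/ x ord0 d = 0) -> x <> (1 - t) *: m + t *: q.
  move=> t0 xs xcd xq; apply: bad.
  have E i : i != a -> i != b -> x ord0 i = 0 -> q ord0 i = 0.
    move=> ia ib; rewrite xq lerp_coord mE// mulr0 add0r => /eqP.
    by rewrite mulf_eq0 gt_eqF//= => /eqP.
  split=> [i iN|].
    apply: E; last exact: xs.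
    - by apply: contraNneq iN => ->; rewrite !inE eqxx.
    - by apply: contraNneq iN => ->; rewrite !inE eqxx orbT.
  by case: xcd => h; [left|right]; apply: E; rewrite // eq_sym.
have [F [H [cH XH HK FK cF]]] := planar_chart hom Xq.
(* [x.1] slides along the edge and the sign of [x.2] selects the page. The weights sum to 1, and
   those at [a] and [b] stay at least 1/8 on the square [-1, 1]^2. *)
pose phi (x : R * R) : 'rV[R]_n := comb
  (2^-1 + x.1 / 4 - `|x.2| / 8) (2^-1 - x.1 / 4 - `|x.2| / 8)
  (Num.max x.2 0 / 4) (Num.max (- x.2) 0 / 4) a b c d.
pose cl (x : R * R) : R * R := (clamp 1 x.1, clamp 1 x.2).
have phic x : phi x ord0 c = Num.max x.2 0 / 4.
  by rewrite combE eqxx ![c == _]eq_sym (negbTE acn) (negbTE bcn)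
    [d == c]eq_sym (negbTE cd) /=; ring.
have phid x : phi x ord0 d = Num.max (- x.2) 0 / 4.
  by rewrite combE eqxx ![d == _]eq_sym (negbTE adn) (negbTE bdn) (negbTE cd) /=; ring.
have phia x : phi x ord0 a = 2^-1 + x.1 / 4 - `|x.2| / 8.
  by rewrite combE eqxx (negbTE abn) (negbTE acn) (negbTE adn) /=; ring.
have phiN x i : i \notin [set a; b; c; d]%SET -> phi x ord0 i = 0.
  rewrite !inE !negb_or -!andbA combE.
  by move=> /and4P[/negbTE -> /negbTE -> /negbTE -> /negbTE ->] /=; ring.
have phicd x : phi x ord0 c = 0 \/ phi x ord0 d = 0.
  rewrite phic phid; case: (leP x.2 0) => h; [left|right].
    by rewrite mul0r.
  by rewrite (max_idPr _) ?mul0r// oppr_le0 ltW.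
have Xphi x : X (phi (cl x)).
  have /andP[u1 u2] := clamp_bound x.1 ler01.
  have /andP[v1 v2] := clamp_bound x.2 ler01.
  rewrite /cl /phi /=; move: (clamp 1 x.1) (clamp 1 x.2) u1 u2 v1 v2 => u v u1 u2 v1 v2.
  have [v0|v0] := leP 0 v.
    rewrite (max_idPr _); last by lra.
    rewrite mul0r ger0_norm//.
    have -> A B C : comb A B C 0 a b c d = comb A B C 0 a b c c :> 'rV[R]_n.
      by rewrite /comb !scale0r.
    by apply: comb_realization; [exact: triangle_clique|lra..].
  rewrite mul0r ltr0_norm// (max_idPl _); last by lra.
  have -> A B C : comb A B 0 C a b c d = comb A B C 0 a b d d :> 'rV[R]_n.
    by rewrite /comb !scale0r addr0 addr0.
  by apply: comb_realization; [exact: triangle_clique|lra..].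
have phiq x : phi x <> q.
  move=> h; apply: (good (phi x) 1 ltr01 (phiN x) (phicd x)).
  by rewrite subrr scale0r add0r scale1r.
have cphi : continuous (fun x => phi (cl x)).
  have c1 : continuous (fun x : R * R => clamp 1 x.1) by apply: continuous_clamp; cont.
  have c2 : continuous (fun x : R * R => clamp 1 x.2) by apply: continuous_clamp; cont.
  have cs (i : 'I_n) : continuous (fun _ : R * R => vert (R := R) i) by move=> ?; exact: cvg_cst.
  rewrite /phi /cl /comb /=; apply: continuous_rowD;
    [apply: continuous_rowD; [apply: continuous_rowD|]|]; apply: continuous_rowZ => //; cont.
pose f x := F (phi (cl x)).
have cf : continuous f by apply: cF.
have clD x : unit_disc x -> cl x = x.
  move=> x1; rewrite /cl !clamp_id -?surjective_pairing//.
    rewrite -(ler_pXn2r (ltn0Sn 1)) ?nnegrE// expr1n real_normK ?num_real//.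
    by have := sqr_ge0 x.1; move: x1; rewrite /unit_disc; lra.
  rewrite -(ler_pXn2r (ltn0Sn 1)) ?nnegrE// expr1n real_normK ?num_real//.
  by have := sqr_ge0 x.2; move: x1; rewrite /unit_disc; lra.
have injf : {in [set x | unit_disc x] &, injective f}.
  move=> x y; rewrite !inE /f => /clD Ex /clD Ey /(congr1 H).
  rewrite !FK//.
  rewrite Ex Ey => e.
  have ec := congr1 (fun x : 'rV[R]_n => x ord0 c) e.
  have ed := congr1 (fun x : 'rV[R]_n => x ord0 d) e.
  have ea := congr1 (fun x : 'rV[R]_n => x ord0 a) e.
  move: ec ed ea; rewrite !phic !phid !phia.
  have mx (z : R) : z = Num.max z 0 - Num.max (- z) 0.
    by case: (leP z 0) => h; [rewrite (max_idPl _)|rewrite (max_idPr _)]; lra.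
  move=> ec ed.
  have e2 : x.2 = y.2 by rewrite (mx x.2) (mx y.2); lra.
  rewrite e2 => ea; have e1 : x.1 = y.1 by lra.
  by rewrite (surjective_pairing x) (surjective_pairing y) e1 e2.
have [e e0 He] := open_image cf injf.
have f0 : f (0, 0) = F m.
  rewrite /f clD; last by rewrite /unit_disc /= expr0n addr0 ler01.
  by rewrite /phi /= oppr0 maxxx normr0 !mul0r addr0 !subr0 /m /midpoint /comb !scale0r.
(* Stopping at 1/2 keeps the path away from [q], where the chart is undefined. *)
pose tau (t : R) := Num.min 2^-1 (Num.max 0 t).
pose x_ t := (1 - tau t) *: m + tau t *: q.
have tau01 t : 0 <= tau t <= 2^-1.
  rewrite /tau; apply/andP; split; last by rewrite ge_min lexx.
  by rewrite le_min invr_ge0 ler0n le_max lexx.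
have Xx t : X (x_ t).
  by apply: Xpath; have /andP[t0 t1] := tau01 t; rewrite t0 /=; lra.
have mq : m <> q.
  move=> h; apply: bad; rewrite -h; split=> [i|].
    by rewrite !inE !negb_or -!andbA => /and4P[ia ib _ _]; exact: mE.
  by left; apply: mE; rewrite eq_sym.
have xq t : x_ t <> q.
  have /andP[t0 t1] := tau01 t.
  move=> h; apply: mq; apply: eq_row0 => i.
  have t1' : 1 - tau t != 0 by rewrite gt_eqF//; lra.
  apply: (mulfI t1'); have := congr1 (fun x : 'rV[R]_n => x ord0 i) h.
  by rewrite /x_ lerp_coord; lra.
have cx : continuous (fun t => F (x_ t)).
  apply: cF => [|t]; last by split; [exact: Xx|exact: xq].
  have ct : continuous tau by rewrite /tau; cont.
  by apply: continuous_rowD; apply: continuous_rowZ; cont.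
pose D t := e - Num.max `|(F (x_ t)).1 - (F m).1| `|(F (x_ t)).2 - (F m).2|.
have cD : continuous D by rewrite /D; cont.
have x0 : x_ 0 = m.
  have t0 : tau 0 = 0 by rewrite /tau maxxx (min_idPr _)// invr_ge0 ler0n.
  by rewrite /x_ t0 subr0 scale1r scale0r addr0.
have : \forall t \near (0 : R), 0 < D t.
  by apply: (cvgr_gt _ (cD 0)); rewrite /D x0 !subrr normr0 maxxx subr0.
move=> /nbhs_ballP [r /= r0 Hr].
pose t := r / 2.
have t0 : 0 < t by rewrite divr_gt0.
have tt : 0 < tau t by rewrite /tau lt_min invr_gt0 ltr0n lt_max t0 orbT.
have : 0 < D t.
  by apply: Hr; rewrite /ball /= sub0r normrN gtr0_norm// ltr_pdivrMr// ltr_pMr// ltr1n.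
rewrite subr_gt0 gt_max -f0 => /andP[h1 h2].
have [u Du] := He _ h1 h2.
rewrite /f => /(congr1 H); rewrite !FK//.
exact: (good _ (tau t) tt (phiN _) (phicd _)).
Qed.

End EdgeLinkUpper.

(** * Links of edges and mod 2 cocycles *)

Section Cohomology.
Context {R : realType} {n : nat} (G : sgraph n).

Local Notation X := (realization R (clique_complex G)).
Hypothesis hom : homeomorphic X (unit_sphere R 3).
Implicit Types a b c d : 'I_n.

(** Both unwanted cases contradict [two_pages_open]. If [c] and [d] were adjacent, flagness would
    make [abcd] a face, and [q] is the midpoint of [cd]; for a third common neighbour [e], [q] is
    the vertex [e]. *)
Lemma edge_link a b : adjacent G a b ->
  exists c d, [/\ c != d, ~~ adjacent G c d &
    forall e, common_neighbour G a b e = (e == c) || (e == d)].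
Proof.
move=> ab; have [c abc] := edge_in_triangle hom ab.
have [d dc abd] := edge_in_two_triangles hom ab abc.
have cd : c != d by rewrite eq_sym.
exists c, d; split=> //.
  apply/negP => acd.
  have C4 : clique G [set a; b; c; d]%SET.
    move: abc abd; rewrite /common_neighbour => /andP[h1 h2] /andP[h3 h4].
    by apply: clique4; rewrite /wadj ?ab ?h1 ?h2 ?h3 ?h4 ?acd ?orbT.
  pose q := comb 0 0 2^-1 2^-1 a b c d : 'rV[R]_n.
  have [acn bcn] := common_neighbour_neq abc; have [adn bdn] := common_neighbour_neq abd.
  have [|t t01|_] := two_pages_open (q := q) hom ab abc abd cd.
  - by apply: comb_realization => //; lra.
  - have -> : (1 - t) *: midpoint a b + t *: q =
        comb ((1 - t) / 2) ((1 - t) / 2) (t / 2) (t / 2) a b c d.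
      apply: eq_row0 => i; rewrite lerp_coord !combE.
      by move: (i == a) (i == b) (i == c) (i == d) => [] [] [] [] /=; field.
    by apply: comb_realization => //; lra.
  have E : (((c == a) = false) * ((c == b) = false) * ((d == a) = false) * ((d == b) = false))%type.
    by rewrite ![c == _]eq_sym ![d == _]eq_sym; do !split; exact: negbTE.
  by rewrite !combE !E (negbTE cd) (negbTE dc) !eqxx /=; case; lra.
move=> e; apply/idP/idP => [abe|/orP[]/eqP ->//].
apply/negPn/negP; rewrite negb_or => /andP[ec ed].
have [aen ben] := common_neighbour_neq abe.
have C3 := triangle_clique ab abe.
have [|t t01|+ _] := two_pages_open (q := vert e) hom ab abc abd cd.
- exact: vert_realization.
- have -> : (1 - t) *: midpoint a b + t *: vert e =
        comb ((1 - t) / 2) ((1 - t) / 2) t 0 a b e e :> 'rV[R]_n.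
    apply: eq_row0 => i; rewrite lerp_coord !combE vertE.
    by move: (i == a) (i == b) (i == e) => [] [] [] /=; field.
  by apply: comb_realization => //; lra.
move=> /(_ e); rewrite !inE !negb_or ec ed ![e == _]eq_sym aen ben vertE eqxx /=.
by move=> /(_ isT) /eqP; rewrite oner_eq0.
Qed.

(** The signed matrix has rank one because a cocycle is a coboundary on each face. From the vertex
    [u] to the midpoint of an edge [uv] the coordinate at [u] is at least 1/2, so the root component
    at [u] keeps its sign; at the midpoint the components at [u] and [v] multiply to (-1)^s / 4.
    Hence [r u] records the sign of the component at [u] taken at the vertex [u]. *)
Lemma cocycle_trivial a b c (s : 'I_n -> 'I_n -> bool) :
  adjacent G a b -> common_neighbour G a b c ->
  (forall u, s u u = false) -> (forall u v, s u v = s v u) ->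
  (forall u v w, adjacent G u v -> adjacent G v w -> adjacent G u w ->
     s u w = s u v (+) s v w) ->
  exists r : 'I_n -> bool, forall u v, adjacent G u v -> s u v = r u (+) r v.
Proof.
move=> ab abc s0 ssym sc.
have abn := adjacent_neq ab; have [acn bcn] := common_neighbour_neq abc.
(* Removing the barycentre of a triangle leaves every edge inside the chart. *)
pose p := comb 3^-1 3^-1 3^-1 0 a b c c : 'rV[R]_n.
have Xp : X p by apply: comb_realization; [exact: triangle_clique|lra..].
have [F [H [cH XH HK FK cF]]] := planar_chart hom Xp.
pose P u v (z : R * R) := (-1) ^+ s u v * (H z ord0 u * H z ord0 v).
have cP u v : continuous (P u v) by rewrite /P; cont.
have rP z : exists w, (exists i, w i != 0) /\ is_root (fun u v => P u v z) w.
  have [/realizationP [z0 z1 zK] _] := XH z.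
  have [u zu] : exists u, H z ord0 u != 0.
    apply: contrapT => no; move/eqP: z1; rewrite big1 => [|i _]; first by rewrite eq_sym oner_eq0.
    by apply/eqP; apply: contrapT => /negP h; apply: no; exists i.
  (* With [u] a vertex of the face carrying the point, the cocycle identity reads s(i, j) = s(u, i)
     + s(u, j) on that face. *)
  exists (fun v => (-1) ^+ s u v * H z ord0 v); split.
    by exists u; rewrite s0 mul1r.
  move=> i j; rewrite /P.
  have [->|zi] := eqVneq (H z ord0 i) 0; first by rewrite !(mul0r, mulr0).
  have [->|zj] := eqVneq (H z ord0 j) 0; first by rewrite !(mul0r, mulr0).
  rewrite mulrACA -signr_addb; congr (_ ^+ nat_of_bool _ * _).
  have [->|ui] := eqVneq u i; first by rewrite s0.
  have [->|uj] := eqVneq u j; first by rewrite s0 addbF ssym.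
  have [->|ij] := eqVneq i j; first by rewrite s0 addbb.
  by rewrite (ssym u i); apply: sc; apply: zK; rewrite // eq_sym.
pose tau (t : R) := Num.min 2^-1 (Num.max 0 t).
have tau01 t : 0 <= tau t <= 2^-1.
  rewrite /tau; apply/andP; split; last by rewrite ge_min lexx.
  by rewrite le_min invr_ge0 ler0n le_max lexx.
have ctau : continuous tau by rewrite /tau; cont.
have tauE t : 0 <= t <= 2^-1 -> tau t = t.
  by move=> /andP[t0 t1]; rewrite /tau (max_idPr t0) (min_idPr t1).
pose x u v t : 'rV[R]_n := (1 - tau t) *: vert u + tau t *: vert v.
have cx u v : continuous (x u v).
  by apply: continuous_rowD; apply: continuous_rowZ; cont; move=> ?; exact: cvg_cst.
have xE u v t : x u v t = comb (1 - tau t) (tau t) 0 0 u v u v.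
  by rewrite /comb !scale0r !addr0.
have Xx u v t : adjacent G u v -> X (x u v t).
  move=> uv; rewrite xE; have /andP[t0 t1] := tau01 t; apply: comb_realization; try lra.
  by apply: clique4; rewrite /wadj ?eqxx ?[adjacent G v u]adjacent_sym ?uv ?orbT.
have xp u v t : x u v t <> p.
  have [k [ku kv pk]] : exists k, [/\ k != u, k != v & p ord0 k = 3^-1].
    have pa : p ord0 a = 3^-1.
      by rewrite combE eqxx (negbTE abn) (negbTE acn) /=; ring.
    have pb : p ord0 b = 3^-1.
      by rewrite combE eqxx eq_sym (negbTE abn) (negbTE bcn) /=; ring.
    have pc : p ord0 c = 3^-1.
      by rewrite combE eqxx ![c == _]eq_sym (negbTE acn) (negbTE bcn) /=; ring.
    case: (boolP ((a != u) && (a != v))) => [/andP[h1 h2]|ha]; first by exists a.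
    case: (boolP ((b != u) && (b != v))) => [/andP[h1 h2]|hb]; first by exists b.
    exists c; split=> //; move: ha hb; rewrite !negb_and !negbK.
      by case/orP => /eqP Ea; case/orP => /eqP Eb;
        [move: abn; rewrite Ea Eb eqxx | rewrite -Ea eq_sym | rewrite -Eb eq_sym
        | move: abn; rewrite Ea Eb eqxx].
    by case/orP => /eqP Ea; case/orP => /eqP Eb;
      [move: abn; rewrite Ea Eb eqxx | rewrite -Eb eq_sym | rewrite -Ea eq_sym
      | move: abn; rewrite Ea Eb eqxx].
  move/(congr1 (fun y : 'rV[R]_n => y ord0 k)); rewrite pk xE combE (negbTE ku) (negbTE kv) /=; lra.
have cFx u v : adjacent G u v -> continuous (fun t => F (x u v t)).
  by move=> uv; apply: cF => // t; split; [exact: Xx|exact: xp].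
(* [continuous_root] works on a bounded square. Each half edge is compact, hence bounded in the
   chart, and the sum of the bounds serves all edges. *)
have /choice[Mb HMb] : forall e : 'I_n * 'I_n, exists m : R, 0 <= m /\
    (adjacent G e.1 e.2 -> forall t, `|(F (x e.1 e.2 t)).1| <= m /\ `|(F (x e.1 e.2 t)).2| <= m).
  move=> [u v] /=; case: (boolP (adjacent G u v)) => [uv|_]; last by exists 0.
  have cFuv := cFx _ _ uv.
  have cN : continuous (fun t => `|(F (x u v t)).1| + `|(F (x u v t)).2|) by cont.
  have i0 : (0 : R) <= 2^-1 by rewrite invr_ge0 ler0n.
  have [t0 _ Ht0] := EVT_max i0 (continuous_subspaceT cN).
  exists (`|(F (x u v t0)).1| + `|(F (x u v t0)).2|); split=> [|_ t].
    by rewrite addr_ge0.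
  have xt : x u v t = x u v (tau t) by rewrite /x (tauE (tau t)).
  have := Ht0 (tau t); rewrite in_itv/= tau01 xt => /(_ isT) h.
  by split; apply: le_trans h; rewrite ?lerDl ?lerDr.
pose M := \sum_e Mb e.
have M0 : 0 <= M by apply: sumr_ge0 => e _; have [] := HMb e.
have MbM e : Mb e <= M.
  by rewrite /M (bigD1 e)//= lerDl sumr_ge0// => e' _; have [] := HMb e'.
have [w [cw rw]] := continuous_root cP rP M0.
have rx u v t : adjacent G u v ->
    is_root (fun i j => P i j (F (x u v t))) (fun i => w i (F (x u v t))).
  move=> uv; have [_ /(_ uv t) [h1 h2]] := HMb (u, v).
  by apply: rw; [apply: le_trans h1 _|apply: le_trans h2 _].
have Px u v t i j : adjacent G u v -> P i j (F (x u v t)) =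
    (-1) ^+ s i j * (x u v t ord0 i * x u v t ord0 j).
  by move=> uv; rewrite /P FK//; exact: Xx.
have x0 u v : x u v 0 = vert u.
  by rewrite /x tauE ?lexx ?invr_ge0 ?ler0n// subr0 scale1r scale0r addr0.
have half : tau 2^-1 = 2^-1 by apply: tauE; rewrite lexx invr_ge0 ler0n.
have x1 u v : x u v 2^-1 = x v u 2^-1.
  by rewrite /x half (_ : 1 - 2^-1 = 2^-1) 1?addrC//; field.
have sgn u v : adjacent G u v -> 0 < w u (F (vert u)) * w u (F (x u v 2^-1)).
  move=> uv; rewrite -(x0 u v); apply: (@ivt_same_sign R (fun t => w u (F (x u v t)))).
  - by rewrite invr_ge0 ler0n.
  - by apply: (@continuous_compose _ _ _ _ (w u)) => //; exact: cFx.
  - move=> t _; apply/eqP => wz; have := rx u v t uv u u; rewrite Px// wz mul0r s0 mul1r.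
    move/eqP; rewrite mulf_eq0 orbb xE combE eqxx (negbTE (adjacent_neq uv)) /=.
    by have /andP[_ h] := tau01 t; move/eqP; lra.
exists (fun u => w u (F (vert u)) < 0) => u v uv.
have vu : adjacent G v u by rewrite adjacent_sym.
have h1 := sgn u v uv; have h2 := sgn v u vu; rewrite -x1 in h2.
have CD : w u (F (x u v 2^-1)) * w v (F (x u v 2^-1)) = (-1) ^+ s u v / 4.
  rewrite -(rx u v 2^-1 uv u v) Px// xE half !combE !eqxx [v == u]eq_sym.
  by rewrite (negbTE (adjacent_neq uv)) /=; congr (_ * _); field.
move: h1 h2 CD => /=.
move: (w u (F (vert u))) (w v (F (vert v))) (w u (F (x u v 2^-1))) (w v (F (x u v 2^-1))).
move=> A B C D AC BD CD.
have : 0 < (A * B) * (C * D) by rewrite mulrACA mulr_gt0.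
rewrite CD; case: (s u v); case: (ltP A 0) => A0; case: (ltP B 0) => B0 //=;
  rewrite ?expr1 ?expr0 => AB; exfalso; nra.
Qed.

End Cohomology.

(** * Counting triangles *)

Section Counting.
Import mathcomp.boot.fintype mathcomp.boot.finset.
Context {n : nat} (G : sgraph n).

Hypothesis n_gt0 : (0 < n)%N.
Hypothesis no_isolated : forall a, exists b, adjacent G a b.
Hypothesis link : forall a b, adjacent G a b -> exists c d,
  [/\ c != d, ~~ adjacent G c d &
      forall e, common_neighbour G a b e = (e == c) || (e == d)].
Hypothesis cocycle : forall s : 'I_n -> 'I_n -> bool,
  (forall u, s u u = false) -> (forall u v, s u v = s v u) ->
  (forall u v w, adjacent G u v -> adjacent G v w -> adjacent G u w ->
     s u w = s u v (+) s v w) ->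
  exists r : 'I_n -> bool, forall u v, adjacent G u v -> s u v = r u (+) r v.

Implicit Types (a b c d : 'I_n) (t e : {set 'I_n}).
Local Open Scope nat_scope.
Local Open Scope set_scope.

Definition triangle a b c : bool :=
  [&& adjacent G a b, adjacent G b c & adjacent G a c].

Definition triangles : {set {set 'I_n}} :=
  [set t | [exists a, exists b, exists c, triangle a b c && (t == [set a; b; c])]].

Lemma trianglesP t : reflect (exists a b c, triangle a b c /\ t = [set a; b; c])
  (t \in triangles).
Proof.
rewrite inE; apply: (iffP existsP) => [[a /existsP[b /existsP[c /andP[abc /eqP->]]]]|].
  by exists a, b, c.
move=> [a [b [c [abc ->]]]]; exists a; apply/existsP; exists b; apply/existsP.
by exists c; rewrite abc eqxx.
Qed.

Lemma edge_pair e : e \in edges G -> exists a b, adjacent G a b /\ e = [set a; b].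
Proof.
move=> eE; have /forallP/(_ e)/implyP/(_ eE) e2 := edgesP G.
have [a [b [ab eab]]] := cards2P _ e2.
by exists a, b; rewrite /adjacent -eab.
Qed.

Lemma triangle_edges a b c : triangle a b c ->
  [set e in edges G | e \subset [set a; b; c]] = [set [set a; b]; [set b; c]; [set a; c]].
Proof.
move=> /and3P[ab bc ac]; apply/setP => e; rewrite [RHS]inE [X in X || _]inE !in_set1 [LHS]inE.
apply/andP/idP => [[eE]|]; last first.
  by move=> /orP[/orP[]|] /eqP ->; split=> //;
    apply/subsetP => x; rewrite !inE => /orP[] ->; rewrite ?orbT.
have [x [y [xy ->]]] := edge_pair eE.
rewrite subUset !sub1set !inE -!orbA => /andP[].
have nn z : adjacent G z z = false by exact: adjacent_irr.
by case/or3P => /eqP ex; case/or3P => /eqP ey; move: xy; rewrite ex ey ?nn ?eqxx ?orbT//;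
  rewrite setUC eqxx ?orbT.
Qed.

Lemma set_neqP (T : finType) (A B : {set T}) x : x \in B -> x \notin A -> A != B.
Proof. by move=> xB; apply: contraNneq => ->. Qed.

Lemma triangle_edges_uniq a b c : triangle a b c ->
  uniq [:: [set a; b]; [set b; c]; [set a; c]].
Proof.
move=> /and3P[/adjacent_neq ab /adjacent_neq bc /adjacent_neq ac].
have ca : c != a by rewrite eq_sym.
have cb : c != b by rewrite eq_sym.
rewrite /= !inE negb_or andbT; apply/andP; split; [apply/andP; split|].
- by apply: (@set_neqP _ _ _ c); rewrite !inE ?eqxx ?orbT// (negbTE ca) (negbTE cb).
- by apply: (@set_neqP _ _ _ c); rewrite !inE ?eqxx ?orbT// (negbTE ca) (negbTE cb).
- by apply: (@set_neqP _ _ _ a); rewrite !inE ?eqxx ?orbT// (negbTE ab) (negbTE ac).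
Qed.

Lemma card_triangle_edges t : t \in triangles ->
  #|[set e in edges G | e \subset t]| = 3.
Proof.
move=> /trianglesP[a [b [c [abc ->]]]]; rewrite triangle_edges//.
have /card_uniqP := triangle_edges_uniq abc => /= <-; apply: eq_card => e.
by rewrite !inE orbA.
Qed.

Lemma edge_triangles a b c d : adjacent G a b -> c != d ->
  (forall x, common_neighbour G a b x = (x == c) || (x == d)) ->
  [set t in triangles | [set a; b] \subset t] = [set [set a; b; c]; [set a; b; d]].
Proof.
move=> ab cd abE; have nn z : adjacent G z z = false by exact: adjacent_irr.
have tri x : (x == c) || (x == d) -> [set a; b; x] \in triangles.
  rewrite -abE => /andP[ax bx]; apply/trianglesP; exists a, b, x.
  by rewrite /triangle ab ax bx.
apply/setP => t; rewrite [RHS]inE !in_set1 [LHS]inE.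
apply/andP/idP => [[/trianglesP[x [y [z [/and3P[xy yz xz] ->]]]]]|]; last first.
  move=> /orP[] /eqP ->; (split; first by apply: tri; rewrite eqxx ?orbT);
  by apply/subsetP => x; rewrite !inE => /orP[] ->; rewrite ?orbT.
rewrite subUset !sub1set !inE -!orbA => /andP[].
have yx : adjacent G y x by rewrite adjacent_sym.
have zy : adjacent G z y by rewrite adjacent_sym.
have zx : adjacent G z x by rewrite adjacent_sym.
have fin (e : 'I_n) : common_neighbour G a b e ->
    ([set a; b; e] == [set a; b; c]) || ([set a; b; e] == [set a; b; d]).
  by rewrite abE => /orP[] /eqP ->; rewrite eqxx ?orbT.
have P1 (p q r : 'I_n) : [set p; q; r] = [set q; p; r].
  by rewrite [[set p; q]]setUC.
have P2 (p q r : 'I_n) : [set p; q; r] = [set p; r; q].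
  by rewrite -!setUA [[set q; r]]setUC.
case/or3P => /eqP ea; case/or3P => /eqP eb; subst a b; rewrite ?nn// in ab *.
- by apply: fin; rewrite /common_neighbour xz yz.
- by rewrite P2; apply: fin; rewrite /common_neighbour xy zy.
- by rewrite P1; apply: fin; rewrite /common_neighbour xz yz.
- by rewrite P1 P2; apply: fin; rewrite /common_neighbour yx zx.
- by rewrite P2 P1; apply: fin; rewrite /common_neighbour xy zy.
- by rewrite P1 P2 P1; apply: fin; rewrite /common_neighbour yx zx.
Qed.

Lemma card_edge_triangles e : e \in edges G ->
  #|[set t in triangles | e \subset t]| = 2.
Proof.
move=> /edge_pair[a [b [ab ->]]]; have [c [d [cd _ abE]]] := link ab.
rewrite (edge_triangles ab cd abE) cards2.
have /common_neighbour_neq[ad bd] : common_neighbour G a b d by rewrite abE eqxx orbT.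
rewrite (@set_neqP _ _ _ d) ?inE ?eqxx ?orbT//.
by rewrite ![d == _]eq_sym (negbTE ad) (negbTE bd) (negbTE cd).
Qed.

Lemma triangles_edges_count : 3 * #|triangles| = 2 * #|edges G|.
Proof.
rewrite mulnC -sum_nat_const [RHS]mulnC -sum_nat_const.
under eq_bigr => t tT do rewrite -(card_triangle_edges tT) -sum1_card.
under [RHS]eq_bigr => e eE do rewrite -(card_edge_triangles eE) -sum1_card.
under eq_bigr do under eq_bigl do rewrite inE.
under [RHS]eq_bigr do under eq_bigl do rewrite inE.
rewrite (exchange_big_dep (mem (edges G)))/=; last by move=> t e _ /andP[].
by apply: eq_bigr => e eE; apply: eq_bigl => t; rewrite eE.
Qed.

(** Besides [abc] and [abd], crossing the edges [ac] and [ad] gives [ace] and [adf] with [e] and [f]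
    different from [b]. Since [c] and [d] are not adjacent, [c] differs from [f], which separates
    the last two; [e] = [f] is allowed and occurs at a vertex of degree 4. *)
Lemma four_triangles a : 4 <= #|[set t in triangles | a \in t]|.
Proof.
have [b ab] := no_isolated a; have [c [d [cd ncd abE]]] := link ab.
have /andP[ac bc] : common_neighbour G a b c by rewrite abE eqxx.
have /andP[ad bd] : common_neighbour G a b d by rewrite abE eqxx orbT.
have other x y : adjacent G a x -> common_neighbour G a x y ->
    exists2 z, z != y & common_neighbour G a x z.
  move=> ax; have [p [q [pq _ axE]]] := link ax; rewrite axE => /orP[] /eqP ->.
    by exists q; rewrite 1?eq_sym// axE eqxx orbT.
  by exists p; rewrite // axE eqxx.
have [|e eb /andP[ae ce]] := other c b ac.
  by rewrite /common_neighbour ab adjacent_sym.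
have [|f fb /andP[af df]] := other d b ad.
  by rewrite /common_neighbour ab adjacent_sym.
have tri x y : adjacent G a x -> adjacent G a y -> adjacent G x y ->
    [set a; x; y] \in [set t in triangles | a \in t].
  move=> ax ay xy; rewrite inE; apply/andP; split; last by rewrite !inE eqxx.
  by apply/trianglesP; exists a, x, y; rewrite /triangle ax ay xy.
pose s := [:: [set a; b; c]; [set a; b; d]; [set a; c; e]; [set a; d; f]].
have us : uniq s.
  have da : d != a by rewrite eq_sym (adjacent_neq ad).
  have db : d != b by rewrite eq_sym (adjacent_neq bd).
  have dc : d != c by rewrite eq_sym.
  have ba : b != a by rewrite eq_sym (adjacent_neq ab).
  have bc' := adjacent_neq bc; have bd' := adjacent_neq bd.
  have ca : c != a by rewrite eq_sym (adjacent_neq ac).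
  have cf : c != f by apply: contraNneq ncd => ->; rewrite adjacent_sym.
  have be : b != e by rewrite eq_sym.
  have bf : b != f by rewrite eq_sym.
  rewrite /s /= !inE !negb_or andbT -!andbA.
  apply/and5P; split; [| | | |apply/andP; split].
  - by apply: (@set_neqP _ _ _ d); rewrite !inE ?eqxx ?orbT// !negb_or da db dc.
  - by rewrite eq_sym; apply: (@set_neqP _ _ _ b); rewrite !inE ?eqxx ?orbT// !negb_or ba bc' be.
  - by rewrite eq_sym; apply: (@set_neqP _ _ _ b); rewrite !inE ?eqxx ?orbT// !negb_or ba bd' bf.
  - by rewrite eq_sym; apply: (@set_neqP _ _ _ b); rewrite !inE ?eqxx ?orbT// !negb_or ba bc' be.
  - by rewrite eq_sym; apply: (@set_neqP _ _ _ b); rewrite !inE ?eqxx ?orbT// !negb_or ba bd' bf.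
  - by rewrite eq_sym; apply: (@set_neqP _ _ _ c); rewrite !inE ?eqxx ?orbT// !negb_or ca cd cf.
have -> : 4 = size s by [].
rewrite -(card_uniqP us); apply/subset_leq_card/subsetP => t.
rewrite !in_cons in_nil orbF => /or4P[] /eqP ->; by apply: tri.
Qed.

Lemma stable_triangles (S : {set 'I_n}) : stable G S -> 4 * #|S| <= #|triangles|.
Proof.
move=> /forallP stS; rewrite mulnC -sum_nat_const.
apply: (@leq_trans (\sum_(a in S) #|[set t in triangles | a \in t]|)).
  by apply: leq_sum => a _; exact: four_triangles.
under eq_bigr do rewrite -sum1_card.
under eq_bigr do under eq_bigl do rewrite inE.
rewrite (exchange_big_dep (mem triangles))/=; last by move=> a t _ /andP[].
rewrite -sum1_card; apply: leq_sum => t tT; rewrite sum1_card.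
apply/card_le1_eqP => a b; rewrite -!topredE /= => /and3P[aS _ at_] /and3P[bS _ bt].
have [x [y [z [/and3P[xy yz xz] te]]]] := trianglesP _ tT.
apply/eqP; apply: contraT => ab.
have /implyP/(_ aS)/forallP/(_ b)/implyP/(_ bS)/negP[] := stS a.
move: at_ bt ab; rewrite te !inE -!orbA => /or3P[] /eqP -> /or3P[] /eqP ->;
  by rewrite ?eqxx// => _; rewrite // adjacent_sym.
Qed.

(** The all-ones column is a nonzero vector killed by [M]. *)
Lemma rank_lt_of_row_sums (F : fieldType) p q (M : 'M[F]_(p, q)) :
  (0 < q)%N -> (forall i, \sum_j M i j = 0)%R -> (\rank M < q)%N.
Proof.
move=> q0 Ms; rewrite ltn_neqAle rank_leq_col andbT; apply/negP => /row_fullP[N NM].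
have M0 : (M *m (const_mx 1 : 'cV_q) = 0)%R.
  apply/matrixP => i j; rewrite !mxE -[RHS](Ms i); apply: eq_bigr => k _.
  by rewrite mxE mulr1.
have := congr1 (mulmx N) M0; rewrite mulmxA NM mul1mx mulmx0.
by move=> /matrixP/(_ (Ordinal q0) ord0)/eqP; rewrite !mxE oner_eq0.
Qed.

Lemma F2_bool (x : 'F_2) : x = (x != 0)%:R%R.
Proof. by case: x => [[|[|]]] //= i; apply: val_inj. Qed.

Lemma F2_addb (x y : bool) : ((x (+) y)%:R = x%:R + y%:R :> 'F_2)%R.
Proof. by case: x; case: y; apply: val_inj. Qed.

Lemma sum_enum_val (V : nmodType) (T : finType) (S : {set T}) (F : T -> V) :
  (\sum_(i < #|S|) F (enum_val i) = \sum_(t in S) F t)%R.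
Proof. by rewrite -big_enum_val. Qed.

Lemma F2_sum_eq0 (x y z : 'F_2) : (x + y + z = 0)%R ->
  (z != 0)%R = (x != 0)%R (+) (y != 0)%R.
Proof.
by move: x y z => [[|[|]]] //= ? [[|[|]]] //= ? [[|[|]]] //= ? /(congr1 val).
Qed.

(** Acting on row vectors, [A] is the mod 2 coboundary from edges to triangles, and the rows of [B]
    span the coboundaries of vertex functions. Triviality of cocycles says that the kernel of [A]
    lies in the row space of [B], so E - rank A <= rank B. *)
Lemma edges_bound : #|edges G| + 2 <= #|triangles| + n.
Proof.
have [b0 ab0] := no_isolated (Ordinal n_gt0).
have e0E : [set Ordinal n_gt0; b0] \in edges G by exact: ab0.
have T0 : 0 < #|triangles|.
  have := triangles_edges_count; have : 0 < #|edges G| by apply/card_gt0P; eexists; exact: e0E.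
  by lia.
pose A : 'M['F_2]_(#|edges G|, #|triangles|) :=
  (\matrix_(i, j) ((enum_val i : {set 'I_n}) \subset (enum_val j : {set 'I_n}))%:R)%R.
pose B : 'M['F_2]_(n, #|edges G|) := (\matrix_(v, i) (v \in (enum_val i : {set 'I_n}))%:R)%R.
have rA : \rank A < #|triangles|.
  apply: rank_lt_of_row_sums => // i.
  under eq_bigr do rewrite mxE.
  rewrite (sum_enum_val triangles (fun t => ((enum_val i : {set 'I_n}) \subset t)%:R%R : 'F_2)).
  rewrite -natr_sum (_ : \sum_(t in triangles) _ = 2); first exact: val_inj.
  rewrite -(card_edge_triangles (enum_valP i)) -sum1_card.
  under [RHS]eq_bigl do rewrite inE.
  by rewrite big_mkcondr; apply: eq_bigr => t _; case: (_ \subset _).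
have rB : \rank B < n.
  rewrite -mxrank_tr; apply: rank_lt_of_row_sums => // i.
  under eq_bigr do rewrite !mxE.
  have [x [y [xy ->]]] := edge_pair (enum_valP i).
  rewrite -natr_sum (_ : \sum_v _ = 2); first exact: val_inj.
  rewrite -[RHS](_ : #|[set x; y]| = 2); last by rewrite cards2 (adjacent_neq xy).
  by rewrite -sum1_card [RHS]big_mkcond; apply: eq_bigr => v _; case: (_ \in _).
have rK : (kermx A <= B)%MS.
  apply/row_subP => k; have : (row k (kermx A) *m A = 0)%R by rewrite -row_mul mulmx_ker row0.
  move: (row k (kermx A)) => u uA.
  pose U e : 'F_2 := u ord0 (enum_rank_in e0E e).
  have Uker t : t \in triangles -> (\sum_(e in edges G | e \subset t) U e = 0)%R.
    move=> tT; have := congr1 (fun M : 'rV_#|triangles| => M ord0 (enum_rank_in tT t)) uA.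
    rewrite mxE [RHS]mxE => uA0; rewrite -[RHS]uA0 big_mkcondr /=.
    rewrite -(sum_enum_val (edges G) (fun e => if e \subset t then U e else 0%R)).
    apply: eq_bigr => i _; rewrite mxE enum_rankK_in// /U enum_valK_in.
    by case: (_ \subset _); rewrite ?mulr1 ?mulr0.
  (* On a pair that is not an edge, [U] returns the value at the default edge; the adjacency guard
     discards it. *)
  pose s x y := adjacent G x y && (U [set x; y] != 0)%R.
  have [x|x y|x y z xy yz xz|r rE] := cocycle (s := s).
  - by rewrite /s adjacent_irr.
  - by rewrite /s adjacent_sym setUC.
  - have xyz : triangle x y z by rewrite /triangle xy yz xz.
    have tT : [set x; y; z] \in triangles by apply/trianglesP; exists x, y, z.
    rewrite /s xy yz xz; apply: F2_sum_eq0; rewrite -[RHS](Uker _ tT).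
    transitivity (\sum_(e in [set [set x; y]; [set y; z]; [set x; z]]) U e)%R.
      have := triangle_edges_uniq xyz; rewrite /= !inE negb_or andbT => /andP[/andP[h1 h2] h3].
      rewrite -setUA big_setU1 ?inE ?negb_or ?h1//= big_setU1 ?inE//= big_set1.
      by rewrite addrA.
    by rewrite -(triangle_edges xyz); apply: eq_bigl => e; rewrite inE.
  apply/submxP; exists (\row_v (r v)%:R)%R; apply/rowP => i.
  have [x [y [xy exy]]] := edge_pair (enum_valP i).
  have := rE _ _ xy; rewrite /s xy /= /U -exy enum_valK_in => uxy.
  rewrite [LHS]F2_bool uxy F2_addb mxE.
  transitivity (\sum_(v in [set x; y]) (r v)%:R : 'F_2)%R.
    by rewrite big_setU1 ?inE ?(adjacent_neq xy)//= big_set1.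
  rewrite big_mkcond; apply: eq_bigr => v _; rewrite !mxE exy.
  by case: (_ \in _); rewrite ?mulr1 ?mulr0.
have := mxrankS rK; rewrite mxrank_ker; lia.
Qed.

Lemma stable_bound (S : {set 'I_n}) : stable G S -> #|S| <= (n - 2) %/ 2.
Proof.
move=> /stable_triangles; have := triangles_edges_count; have := edges_bound; lia.
Qed.

End Counting.

(** * The suspension of a cycle *)

Section Bipyramid.

(** Stated on natural numbers, with every clause in both orders, so that adjacency questions reduce
    to [lia]. *)
Definition bipyramid_rel (n i j : nat) : bool :=
  [|| (i < 2) && (2 <= j), (j < 2) && (2 <= i),
      (2 <= i) && (j == i.+1), (2 <= j) && (i == j.+1),
      (i == 2) && (j.+1 == n) | (j == 2) && (i.+1 == n)]%N.

Definition bipyramid_edges n : {set {set 'I_n}} :=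
  [set e : {set 'I_n} | [exists i : 'I_n, exists j : 'I_n,
     [&& i != j, bipyramid_rel n i j & e == [set i; j]%SET]]]%SET.

Lemma bipyramid_edgesP n : [forall e in bipyramid_edges n, #|e| == 2%N].
Proof.
apply/forallP => e; apply/implyP; rewrite inE.
by move=> /existsP[i /existsP[j /and3P[ij _ /eqP ->]]]; rewrite cards2 ij.
Qed.

(* The suspension, with apexes [0] and [1], of the cycle [2, 3, ..., n - 1]. *)
Definition bipyramid n : sgraph n := SGraph (bipyramid_edgesP n).

Lemma bipyramid_adjacent n (i j : 'I_n) :
  adjacent (bipyramid n) i j = (i != j) && bipyramid_rel n i j.
Proof.
rewrite /adjacent inE; apply/existsP/andP => [[x /existsP[y /and3P[xy r /eqP e]]]|[ij r]].
  have sr : bipyramid_rel n y x by move: r; rewrite /bipyramid_rel; lia.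
  have ix : i \in [set x; y]%SET by rewrite -e !inE eqxx.
  have jx : j \in [set x; y]%SET by rewrite -e !inE eqxx orbT.
  have xi : x \in [set i; j]%SET by rewrite e !inE eqxx.
  have yi : y \in [set i; j]%SET by rewrite e !inE eqxx orbT.
  move: ix jx xi yi; rewrite !inE.
  move=> /orP[] /eqP -> /orP[] /eqP ->; rewrite ?eqxx /= ?orbb ?[y == x]eq_sym ?(negbTE xy) //.
by exists i; apply/existsP; exists j; rewrite ij r eqxx.
Qed.

Context {R : realType}.
Local Notation K n := (realization R (clique_complex (bipyramid n))).

Lemma bipyramidP n (x : 'rV[R]_n) : K n x <->
  [/\ forall i, 0 <= x ord0 i, \sum_i x ord0 i = 1 &
      forall i j : 'I_n, i != j -> x ord0 i != 0 -> x ord0 j != 0 ->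
        bipyramid_rel n i j].
Proof.
split=> [/realizationP[x0 x1 xK]|[x0 x1 xK]].
  by split=> // i j ij xi xj; have := xK _ _ ij xi xj; rewrite bipyramid_adjacent => /andP[].
apply/realizationP; split=> // i j ij xi xj.
by rewrite bipyramid_adjacent ij xK.
Qed.

Lemma within_continuous_precomp (X Y Z : topologicalType) (A : set X) (B : set Y)
    (f : Y -> Z) (phi : X -> Y) :
  {within B, continuous f} -> continuous phi -> phi @` A `<=` B ->
  {within A, continuous (f \o phi)}.
Proof.
move=> /subspace_continuousP cf cphi AB; apply/subspace_continuousP => x Ax W HW.
have Bx : B (phi x) by apply: AB; exists x.
have {}HW : nbhs (phi x) [set u | B u -> W (f u)].
  exact: (cf (phi x) Bx W HW).
have := cphi x _ HW; rewrite !nbhs_simpl /=.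
apply: filterS => s /= H As; apply: H; apply: AB; by exists s.
Qed.

Lemma homeomorphic_precomp (X Y Z : topologicalType) (A : set X) (B : set Y)
    (C : set Z) (phi : X -> Y) (psi : Y -> X) :
  continuous phi -> continuous psi -> (forall x, A x -> B (phi x)) ->
  (forall y, B y -> A (psi y)) -> (forall x, A x -> psi (phi x) = x) ->
  (forall y, B y -> phi (psi y) = y) -> homeomorphic B C -> homeomorphic A C.
Proof.
move=> cphi cpsi AB BA phiK psiK [f [g [[cf cg] [fB gC] fK gK]]].
have gB z : C z -> B (g z) by move=> Cz; apply: gC; exists z.
exists (f \o phi), (psi \o g); split.
- split; first by apply: (within_continuous_precomp cf) => // _ [x Ax <-]; exact: AB.
  by apply: within_continuous_comp => // y _; exact: cpsi.
- split=> _ [x xA <-] /=; first by apply: fB; exists (phi x) => //; exact: AB.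
  by apply: BA; exact: gB.
- move=> x; rewrite inE => Ax /=.
  by rewrite fK ?phiK// inE; exact: AB.
- move=> z; rewrite inE => Cz /=.
  by rewrite psiK ?gK ?inE//; exact: gB.
Qed.

(** * Subdividing the closing edge of the equator *)

Section Subdivision.
Variable m : nat.
Hypothesis m5 : (5 <= m)%N.

Let at2 (y : 'rV[R]_m.+1) : R := y ord0 (inord 2).
Let last (y : 'rV[R]_m.+1) : R := y ord0 (inord m).
Let bend (i : nat) : bool := ((i == 2) || (i == m))%N.

(** The new vertex m + 1 goes to the midpoint of the edge {2, m} that closes the cycle 2, ..., m;
    the larger graph replaces this edge by the path 2, m + 1, m. *)
Definition merge_vertex (x : 'rV[R]_m.+2) : 'rV[R]_m.+1 :=
  \row_i (x ord0 (widen_ord (leqnSn _) i) + (bend i)%:R * (x ord0 ord_max / 2)).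

(** A point with weights p at 2 and q at m is min(p, q) times 2 at the midpoint of {2, m}, plus a
    remainder at one end only. The minimum vanishes off the faces containing this edge, where
    nothing moves. *)
Definition split_edge (y : 'rV[R]_m.+1) : 'rV[R]_m.+2 :=
  \row_j (if j == m.+1 :> nat then 2 * Num.min (at2 y) (last y)
          else y ord0 (inord j) - (bend j)%:R * Num.min (at2 y) (last y)).

Lemma continuous_merge : continuous merge_vertex.
Proof. by rewrite /merge_vertex; cont. Qed.

Lemma continuous_split : continuous split_edge.
Proof.
rewrite /split_edge /at2 /last; apply: continuous_row => j.
by case: (_ == _); cont.
Qed.

Lemma sum_bend (c : R) : \sum_(i < m.+1) (bend i)%:R * c = 2 * c.
Proof.
have i2 : (2 < m.+1)%N by lia.
have max2 : ord_max != Ordinal i2 by rewrite -(inj_eq val_inj) /=; lia.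
rewrite (bigD1 (Ordinal i2))// (bigD1 ord_max)// [\sum_(i | _) _]big1; last first.
  move=> i; rewrite -!(inj_eq val_inj) => /andP[/negbTE /= h1 /negbTE /= h2].
  by rewrite /bend h1 h2 /= mul0r.
by rewrite /bend /= !eqxx orbT /=; ring.
Qed.

Lemma widen_inord (i : 'I_m.+2) : i != m.+1 :> nat ->
  widen_ord (leqnSn _) (inord i : 'I_m.+1) = i.
Proof. by move=> im; apply: val_inj; rewrite /= inordK//; have := ltn_ord i; lia. Qed.

Lemma merge_realization x : K m.+2 x -> K m.+1 (merge_vertex x).
Proof.
move=> /bipyramidP[x0 x1 xK]; apply/bipyramidP; split=> [i||i j ij].
- by rewrite mxE addr_ge0// mulr_ge0// divr_ge0.
- under eq_bigr do rewrite mxE.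
  rewrite big_split /= sum_bend -[RHS]x1 [RHS]big_ord_recr /=; congr (_ + _).
    by rewrite mulrC divfK// pnatr_eq0.
have src k : merge_vertex x ord0 k != 0 ->
    x ord0 (widen_ord (leqnSn _) k) != 0 \/ bend k /\ x ord0 ord_max != 0.
  rewrite mxE => h; have [z|] := eqVneq (x ord0 (widen_ord (leqnSn _) k)) 0; last by left.
  right; move: h; rewrite z add0r; case: (bend k) => /=; last by rewrite mul0r eqxx.
  by rewrite mul1r mulf_eq0 => /norP[].
have ijn : i != j :> nat by rewrite (inj_eq val_inj).
have li := ltn_ord i; have lj := ltn_ord j.
move=> /src[xi|[bi xm]] /src[xj|[bj xm']].
- have := xK _ _ _ xi xj; rewrite -(inj_eq val_inj) /= => /(_ ijn).
  by rewrite /bipyramid_rel; lia.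
- have := xK _ _ _ xi xm'; rewrite -(inj_eq val_inj) /= => h.
  have {h}/h : (i != m.+1 :> nat) by lia.
  by move: bj; rewrite /bend /bipyramid_rel; lia.
- have := xK _ _ _ xj xm; rewrite -(inj_eq val_inj) /= => h.
  have {h}/h : (j != m.+1 :> nat) by lia.
  by move: bi; rewrite /bend /bipyramid_rel; lia.
- by move: bi bj; rewrite /bend /bipyramid_rel; lia.
Qed.

Lemma split_coord (y : 'rV[R]_m.+1) (i : 'I_m.+1) :
  split_edge y ord0 (widen_ord (leqnSn _) i) =
  y ord0 i - (bend i)%:R * Num.min (at2 y) (last y).
Proof. by rewrite mxE /= ltn_eqF//= ?inord_val// ltn_ord. Qed.

Lemma split_realization y : K m.+1 y -> K m.+2 (split_edge y).
Proof.
move=> /bipyramidP[y0 y1 yK].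
have mu2 : Num.min (at2 y) (last y) <= at2 y by rewrite ge_min lexx.
have mum : Num.min (at2 y) (last y) <= last y by rewrite ge_min lexx orbT.
have mu0 : 0 <= Num.min (at2 y) (last y) by rewrite le_min !y0.
have lt2 : (2 < m.+1)%N by lia.
have E2 (i : 'I_m.+1) : i = 2%N :> nat -> y ord0 i = at2 y.
  by move=> e; rewrite /at2; congr (y _ _); apply: val_inj; rewrite /= inordK ?e.
have Em (i : 'I_m.+1) : i = m :> nat -> y ord0 i = last y.
  by move=> e; rewrite /last; congr (y _ _); apply: val_inj; rewrite /= inordK ?e.
have split0 (i : 'I_m.+1) : 0 <= y ord0 i - (bend i)%:R * Num.min (at2 y) (last y).
  rewrite /bend; case: eqP => [/E2 ->|_] /=; first by rewrite mul1r subr_ge0.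
  by case: eqP => [/Em ->|_] /=; rewrite ?mul1r ?mul0r ?subr0 ?subr_ge0.
apply/bipyramidP; split=> [j||j k jk].
- case: (unliftP ord_max j) => [i|] ->.
    have -> : lift ord_max i = widen_ord (leqnSn _) i
      by apply: val_inj; rewrite /= /bump leqNgt ltn_ord.
    by rewrite split_coord.
  by rewrite mxE eqxx mulr_ge0.
- rewrite big_ord_recr /= mxE eqxx.
  under eq_bigr do rewrite split_coord.
  by rewrite sumrB sum_bend y1 subrK.
(* An end of the split edge survives only if its weight differs from the minimum, so 2 and m never
   survive together. *)
have src (i : 'I_m.+2) : split_edge y ord0 i != 0 ->
    (i = m.+1 :> nat /\ 0 < at2 y /\ 0 < last y) \/
    exists i' : 'I_m.+1, [/\ i = i' :> nat, y ord0 i' != 0 &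
      bend i' -> Num.min (at2 y) (last y) != y ord0 i'].
  rewrite mxE; case: (nat_of_ord i =P m.+1) => [im|im].
    rewrite mulf_eq0 pnatr_eq0 /= => h; left; split=> //.
    by apply/andP; rewrite -lt_min lt0r h mu0.
  have il : (i < m.+1)%N by have := ltn_ord i; lia.
  have ei : inord i = Ordinal il by apply: val_inj; rewrite /= inordK.
  rewrite ei => h; right; exists (Ordinal il); split=> //.
    apply: contraNneq h => h; have := split0 (Ordinal il); rewrite h sub0r /= oppr_ge0 => h'.
    by rewrite eq_le oppr_le0 oppr_ge0 h' mulr_ge0.
  by move=> /= b; rewrite b mul1r in h; rewrite eq_sym -subr_eq0.
have nb (a b : 'I_m.+1) : a != b :> nat -> y ord0 a != 0 -> y ord0 b != 0 -> bipyramid_rel m.+1 a b.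
  by move=> ab; apply: yK; rewrite -(inj_eq val_inj).
have jkn : j != k :> nat by rewrite (inj_eq val_inj).
(* By [m5] the equator has length at least 4, so only the apexes are adjacent to both 2 and m. *)
have apex (i' : 'I_m.+1) : 0 < at2 y -> 0 < last y -> y ord0 i' != 0 ->
    [|| i' < 2, i' == 2%N :> nat | i' == m :> nat]%N.
  move=> y2 ym yi; rewrite !orbA; case: (boolP (_ || _)) => //= h.
  have h1 := nb i' (inord 2) _ yi (lt0r_neq0 y2); have h2 := nb i' (inord m) _ yi (lt0r_neq0 ym).
  rewrite !inordK// in h1 h2; move: h1 h2 h; rewrite /bipyramid_rel; lia.
move=> /src[[jm [y2 ym]]|[j' [jj yj bj]]] /src[[km [y2' ym']]|[k' [kk yk bk]]].
- by move: jkn; rewrite jm km eqxx.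
- by have := apex _ y2 ym yk; rewrite jm kk /bipyramid_rel; lia.
- by have := apex _ y2' ym' yj; rewrite km jj /bipyramid_rel; lia.
have := nb j' k' _ yj yk; rewrite -jj -kk => /(_ jkn).
have bad (a b : 'I_m.+1) : a = 2%N :> nat -> b = m :> nat ->
    (bend a -> Num.min (at2 y) (last y) != y ord0 a) ->
    (bend b -> Num.min (at2 y) (last y) != y ord0 b) -> False.
  move=> a2 bm; rewrite /bend a2 bm !eqxx orbT (E2 a)// (Em b)//.
  by case: leP => _ /(_ isT) h1 /(_ isT) h2; [move: h1|move: h2]; rewrite eqxx.
have [/andP[/eqP j2 /eqP km]|n1] := boolP ((j' == 2%N :> nat) && (k' == m :> nat)).
  by have := bad _ _ j2 km bj bk.
have [/andP[/eqP k2 /eqP jm]|n2] := boolP ((k' == 2%N :> nat) && (j' == m :> nat)).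
  by have := bad _ _ k2 jm bk bj.
by move: n1 n2; rewrite -jj -kk /bipyramid_rel; have := ltn_ord j'; have := ltn_ord k'; lia.
Qed.

(** In the larger graph 2 and m are not adjacent, so one of their weights is 0 and the minimum after
    merging is exactly the half weight received from the new vertex. *)
Lemma split_mergeK x : K m.+2 x -> split_edge (merge_vertex x) = x.
Proof.
move=> /bipyramidP[x0 x1 xK].
have lt2 : (2 < m.+1)%N by lia.
have mu : Num.min (at2 (merge_vertex x)) (last (merge_vertex x)) = x ord0 ord_max / 2.
  rewrite /at2 /last !mxE !inordK// /bend !eqxx orbT !mul1r -addr_minl.
  set u := widen_ord _ _; set v := widen_ord _ _.
  have : ~ (x ord0 u != 0 /\ x ord0 v != 0).
    move=> [xu xv]; have := xK u v _ xu xv; rewrite -(inj_eq val_inj) /= !inordK//.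
    by rewrite /bipyramid_rel; lia.
  have xu := x0 u; have xv := x0 v.
  have [->|u0] := eqVneq (x ord0 u) 0; first by rewrite (min_idPl _)// add0r.
  have [->|v0] := eqVneq (x ord0 v) 0; first by rewrite (min_idPr _)// add0r.
  by case.
apply: eq_row0 => j; rewrite mxE mu; case: eqP => [jm|/eqP jm].
  rewrite mulrC divfK ?pnatr_eq0//; congr (x _ _); exact: val_inj.
by rewrite mxE widen_inord// inordK ?addrK//; have := ltn_ord j; lia.
Qed.

Lemma merge_splitK y : merge_vertex (split_edge y) = y.
Proof.
apply: eq_row0 => i; rewrite mxE split_coord mxE eqxx.
by rewrite [2 * _]mulrC mulfK ?pnatr_eq0// subrK.
Qed.

Lemma bipyramid_subdivision : homeomorphic (K m.+1) (unit_sphere R 3) ->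
  homeomorphic (K m.+2) (unit_sphere R 3).
Proof.
apply: (@homeomorphic_precomp _ _ _ _ _ _ merge_vertex split_edge).
- exact: continuous_merge.
- exact: continuous_split.
- exact: merge_realization.
- exact: split_realization.
- exact: split_mergeK.
- by move=> y _; exact: merge_splitK.
Qed.

End Subdivision.
End Bipyramid.

(** * The octahedron as the unit sphere of the l1 norm *)

Section Octahedron.
Context {R : realType}.
Local Notation K n := (realization R (clique_complex (bipyramid n))).
Local Notation o k := (inord k : 'I_6).
Local Notation i0 := (ord0 : 'I_3).
Local Notation i1 := (lift ord0 ord0 : 'I_3).
Local Notation i2 := (lift ord0 (lift ord0 ord0) : 'I_3).

Lemma forall_ord6 (P : 'I_6 -> Prop) :
  P (o 0) -> P (o 1) -> P (o 2) -> P (o 3) -> P (o 4) -> P (o 5) -> forall i, P i.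
Proof.
move=> h0 h1 h2 h3 h4 h5 [[|[|[|[|[|[|//]]]]]] hi].
- by rewrite (_ : Ordinal hi = o 0)//; apply: val_inj; rewrite /= inordK.
- by rewrite (_ : Ordinal hi = o 1)//; apply: val_inj; rewrite /= inordK.
- by rewrite (_ : Ordinal hi = o 2)//; apply: val_inj; rewrite /= inordK.
- by rewrite (_ : Ordinal hi = o 3)//; apply: val_inj; rewrite /= inordK.
- by rewrite (_ : Ordinal hi = o 4)//; apply: val_inj; rewrite /= inordK.
- by rewrite (_ : Ordinal hi = o 5)//; apply: val_inj; rewrite /= inordK.
Qed.

Lemma sum_ord6 (F : 'I_6 -> R) :
  \sum_i F i = F (o 0) + F (o 1) + F (o 2) + F (o 3) + F (o 4) + F (o 5).
Proof.
rewrite !big_ord_recl big_ord0 addr0 -!addrA.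
by congr (F _ + (F _ + (F _ + (F _ + (F _ + F _))))); apply: val_inj; rewrite /= inordK.
Qed.

Definition pos (a : R) := Num.max a 0.
Definition neg (a : R) := Num.max (- a) 0.

Lemma posneg a : [/\ 0 <= pos a, 0 <= neg a, pos a - neg a = a,
  pos a + neg a = `|a| & pos a = 0 \/ neg a = 0].
Proof.
rewrite /pos /neg; case: (ler0P a) => h.
  by rewrite (max_idPl _) ?oppr_ge0//; split=> //; [lra|lra|left].
rewrite (max_idPr _); last by rewrite oppr_le0 ltW.
by split=> //; [lra|lra|lra|right].
Qed.

Lemma posneg_sub a b : 0 <= a -> 0 <= b -> a = 0 \/ b = 0 ->
  pos (a - b) = a /\ neg (a - b) = b.
Proof.
move=> a0 b0 [->|->]; rewrite /pos /neg ?sub0r ?subr0 ?opprK.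
  by rewrite (max_idPr _) ?oppr_le0// (max_idPl _).
by rewrite (max_idPl _)// (max_idPr _) ?oppr_le0.
Qed.

Definition norm1 (y : 'rV[R]_3) := `|y ord0 i0| + `|y ord0 i1| + `|y ord0 i2|.
Definition norm2 (y : 'rV[R]_3) :=
  Num.sqrt (y ord0 i0 ^+ 2 + y ord0 i1 ^+ 2 + y ord0 i2 ^+ 2).

(** The equator is the cycle 2, 3, 4, 5, so the opposite pairs are (0, 1), (2, 4) and (3, 5), one
    for each axis. *)
Definition axes (x : 'rV[R]_6) : 'rV[R]_3 :=
  row3 (x ord0 (o 0) - x ord0 (o 1)) (x ord0 (o 2) - x ord0 (o 4))
       (x ord0 (o 3) - x ord0 (o 5)).

Definition octant (y : 'rV[R]_3) : 'rV[R]_6 :=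
  \row_(i < 6) [:: pos (y ord0 i0); neg (y ord0 i0); pos (y ord0 i1);
    pos (y ord0 i2); neg (y ord0 i1); neg (y ord0 i2)]`_i.

Definition scale3 (k : R) (y : 'rV[R]_3) : 'rV[R]_3 :=
  row3 (k * y ord0 i0) (k * y ord0 i1) (k * y ord0 i2).

(* The bounds [1/2] and [1] are inactive on the octahedron and on the sphere; they
   make the maps continuous everywhere. *)
Definition to_sphere (x : 'rV[R]_6) := scale3 (Num.max 2^-1 (norm2 (axes x)))^-1 (axes x).
Definition of_sphere (y : 'rV[R]_3) := octant (scale3 (Num.max 1 (norm1 y))^-1 y).

Lemma norm2_ge0 y : 0 <= norm2 y. Proof. exact: sqrtr_ge0. Qed.

Lemma sqr_norm2 y : norm2 y ^+ 2 = y ord0 i0 ^+ 2 + y ord0 i1 ^+ 2 + y ord0 i2 ^+ 2.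
Proof. by rewrite sqr_sqrtr// !addr_ge0// sqr_ge0. Qed.

Lemma norm2_scale k y : 0 <= k -> norm2 (scale3 k y) = k * norm2 y.
Proof.
move=> k0; rewrite /norm2 /scale3 !row3E !exprMn -!mulrDr sqrtrM ?sqr_ge0//.
by rewrite sqrtr_sqr ger0_norm.
Qed.

Lemma norm1_scale k y : 0 <= k -> norm1 (scale3 k y) = k * norm1 y.
Proof. by move=> k0; rewrite /norm1 /scale3 !row3E !normrM (ger0_norm k0) -!mulrDr. Qed.

Lemma scale3K k l y : l * k = 1 -> scale3 l (scale3 k y) = y.
Proof. by move=> lk; rewrite [RHS]row3P /scale3 !row3E !mulrA lk !mul1r. Qed.

(** The sharp constant is sqrt(3). The cruder 2 gives [norm2] >= 1/2 when [norm1] = 1, whence the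
    bound 1/2 in [to_sphere]. *)
Lemma norms_compare y : norm2 y <= norm1 y <= 2 * norm2 y.
Proof.
have n1 : 0 <= norm1 y by rewrite !addr_ge0.
apply/andP; split.
  rewrite -(ler_pXn2r (ltn0Sn 1)) ?nnegrE ?norm2_ge0// sqr_norm2 /norm1.
  rewrite -[y ord0 i0 ^+ 2]real_normK ?num_real// -[y ord0 i1 ^+ 2]real_normK ?num_real//.
  rewrite -[y ord0 i2 ^+ 2]real_normK ?num_real//.
  have := normr_ge0 (y ord0 i0); have := normr_ge0 (y ord0 i1); have := normr_ge0 (y ord0 i2).
  by move: `|_| `|_| `|_| => a b c; nra.
rewrite -(ler_pXn2r (ltn0Sn 1)) ?nnegrE ?mulr_ge0 ?norm2_ge0// exprMn sqr_norm2 /norm1.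
rewrite -[y ord0 i0 ^+ 2]real_normK ?num_real// -[y ord0 i1 ^+ 2]real_normK ?num_real//.
rewrite -[y ord0 i2 ^+ 2]real_normK ?num_real//.
move: `|_| `|_| `|_| => a b c.
have := sqr_ge0 (a - b); have := sqr_ge0 (a - c); have := sqr_ge0 (b - c).
by have := sqr_ge0 a; have := sqr_ge0 b; have := sqr_ge0 c; nra.
Qed.

Lemma unit_sphere_norm2 y : unit_sphere R 3 y <-> norm2 y = 1.
Proof.
rewrite unit_sphere3E -sqr_norm2; split=> [h|->]; last by rewrite expr1n.
by apply/eqP; rewrite -(@pexpr_eq1 _ _ 2) ?norm2_ge0// h.
Qed.

Lemma octantE y : ((octant y ord0 (o 0) = pos (y ord0 i0)) * (octant y ord0 (o 1) = neg (y ord0 i0))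
  * (octant y ord0 (o 2) = pos (y ord0 i1)) * (octant y ord0 (o 4) = neg (y ord0 i1))
  * (octant y ord0 (o 3) = pos (y ord0 i2)) * (octant y ord0 (o 5) = neg (y ord0 i2)))%type.
Proof. by do !split; rewrite mxE inordK. Qed.

Lemma axes_octant y : axes (octant y) = y.
Proof.
rewrite [RHS]row3P /axes !octantE.
by have [_ _ -> _ _] := posneg (y ord0 i0); have [_ _ -> _ _] := posneg (y ord0 i1);
  have [_ _ -> _ _] := posneg (y ord0 i2).
Qed.

Lemma octahedron_opposite x : K 6 x ->
  [/\ x ord0 (o 0) = 0 \/ x ord0 (o 1) = 0, x ord0 (o 2) = 0 \/ x ord0 (o 4) = 0
    & x ord0 (o 3) = 0 \/ x ord0 (o 5) = 0].
Proof.
move=> /bipyramidP[x0 x1 xK].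
have opp (i j : 'I_6) : i != j -> ~~ bipyramid_rel 6 i j -> x ord0 i = 0 \/ x ord0 j = 0.
  move=> ij nr; have [|xi] := eqVneq (x ord0 i) 0; first by left.
  have [|xj] := eqVneq (x ord0 j) 0; first by right.
  by have := xK _ _ ij xi xj; rewrite (negbTE nr).
by split; apply: opp; rewrite -?(inj_eq val_inj) ?inordK //= !inordK.
Qed.

(** Opposite vertices share no face, so their weights are the positive and negative parts of their
    difference. *)
Lemma octant_axes x : K 6 x -> octant (axes x) = x.
Proof.
move=> Kx; have [x0 _ _] := (bipyramidP x).1 Kx; have [p q r] := octahedron_opposite Kx.
have [p1 p2] := posneg_sub (x0 _) (x0 _) p; have [q1 q2] := posneg_sub (x0 _) (x0 _) q.
have [r1 r2] := posneg_sub (x0 _) (x0 _) r.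
by apply: eq_row0; apply: forall_ord6; rewrite octantE /axes !row3E.
Qed.

Lemma norm1_axes x : K 6 x -> norm1 (axes x) = 1.
Proof.
move=> Kx; have [_ <- _] := (bipyramidP x).1 Kx; rewrite sum_ord6.
have E i : x ord0 i = octant (axes x) ord0 i by rewrite octant_axes.
rewrite !E !octantE /norm1.
by have [_ _ _ <- _] := posneg (axes x ord0 i0); have [_ _ _ <- _] := posneg (axes x ord0 i1);
  have [_ _ _ <- _] := posneg (axes x ord0 i2); ring.
Qed.

Lemma octant_realization y : norm1 y = 1 -> K 6 (octant y).
Proof.
move=> y1; apply/bipyramidP.
have [a1 a2 _ a3 a4] := posneg (y ord0 i0); have [b1 b2 _ b3 b4] := posneg (y ord0 i1).
have [c1 c2 _ c3 c4] := posneg (y ord0 i2).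
split.
- by apply: forall_ord6; rewrite octantE.
- by rewrite sum_ord6 !octantE -y1 /norm1 -a3 -b3 -c3; ring.
have bad (p q : R) : p = 0 \/ q = 0 -> p != 0 -> q != 0 -> False.
  by case=> ->; rewrite eqxx.
apply: forall_ord6; apply: forall_ord6;
  rewrite ?eqxx // -?(inj_eq val_inj) ?octantE ?inordK //= => _ h1 h2;
  first [by case: (bad _ _ a4 h1 h2) | by case: (bad _ _ a4 h2 h1)
  | by case: (bad _ _ b4 h1 h2) | by case: (bad _ _ b4 h2 h1)
  | by case: (bad _ _ c4 h1 h2) | by case: (bad _ _ c4 h2 h1)].
Qed.

Lemma continuous_scale3 (T : topologicalType) (k : T -> R) (f : T -> 'rV[R]_3) :
  continuous k -> continuous f -> continuous (fun t => scale3 (k t) (f t)).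
Proof. by move=> ck cf; apply: continuous_row3; cont. Qed.

Lemma continuous_axes : continuous axes.
Proof. by apply: continuous_row3; cont. Qed.

Lemma continuous_octant : continuous octant.
Proof.
apply: continuous_row; apply: forall_ord6; rewrite inordK //= /pos /neg; cont.
Qed.

Lemma continuous_norm1 : continuous norm1.
Proof. by rewrite /norm1; cont. Qed.

Lemma continuous_norm2 : continuous norm2.
Proof. by rewrite /norm2; cont. Qed.

Lemma octahedron_sphere : homeomorphic (K 6) (unit_sphere R 3).
Proof.
have clip x : K 6 x -> Num.max 2^-1 (norm2 (axes x)) = norm2 (axes x) /\ norm2 (axes x) != 0.
  move=> Kx; have /andP[_] := norms_compare (axes x); rewrite norm1_axes// => h.
  by split; [rewrite (max_idPr _)//; lra|rewrite gt_eqF//; lra].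
have clip' y : unit_sphere R 3 y -> Num.max 1 (norm1 y) = norm1 y /\ norm1 y != 0.
  move=> /unit_sphere_norm2 y1; have /andP[h _] := norms_compare y; rewrite y1 in h.
  by split; [rewrite (max_idPr _)|rewrite gt_eqF// (lt_le_trans _ h)].
have inv0 (k : R) : 0 <= k -> 0 <= k^-1 by rewrite invr_ge0.
have n10 y : 0 <= norm1 y by rewrite !addr_ge0.
have toK x : K 6 x -> unit_sphere R 3 (to_sphere x).
  move=> Kx; have [e n0] := clip _ Kx; apply/unit_sphere_norm2.
  by rewrite /to_sphere e norm2_scale ?mulVf// inv0 ?norm2_ge0.
have ofK y : unit_sphere R 3 y -> K 6 (of_sphere y).
  move=> Sy; have [e n0] := clip' _ Sy; apply: octant_realization.
  by rewrite e norm1_scale ?mulVf// inv0.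
exists to_sphere, of_sphere; split.
- split; apply: continuous_subspaceT.
    apply: continuous_scale3; last exact: continuous_axes.
    apply: continuous_inv; first by move=> x; rewrite gt_eqF// lt_max invr_gt0 ltr0n.
    apply: continuous_maxr; first exact: continuous_const.
    apply: (@continuous_compose _ _ _ axes norm2); last exact: continuous_axes.
    exact: continuous_norm2.
  apply: (@continuous_compose _ _ _ _ octant); first exact: continuous_octant.
  apply: continuous_scale3; last by move=> ?; exact: cvg_id.
  apply: continuous_inv; first by move=> x; rewrite gt_eqF// lt_max ltr01.
  by apply: continuous_maxr; [exact: continuous_const|exact: continuous_norm1].
- by split=> _ [x Hx <-]; [exact: toK|exact: ofK].
- move=> x; rewrite inE => Kx; rewrite /of_sphere.
  have [_ n0] := clip' _ (toK _ Kx); have [-> _] := clip' _ (toK _ Kx).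
  have [e m0] := clip _ Kx; rewrite /to_sphere e norm1_scale ?inv0 ?norm2_ge0//.
  by rewrite norm1_axes// mulr1 invrK scale3K ?mulfV// octant_axes.
- move=> y; rewrite inE => Sy; rewrite /to_sphere /of_sphere axes_octant.
  have [e n0] := clip' _ Sy; have [e' _] := clip _ (ofK _ Sy).
  rewrite /of_sphere axes_octant in e'; rewrite e' e norm2_scale ?inv0//.
  have /unit_sphere_norm2 -> := Sy.
  by rewrite mulr1 invrK scale3K// mulfV.
Qed.

Lemma bipyramid_sphere n : (6 <= n)%N -> triangulates_sphere R 3 (clique_complex (bipyramid n)).
Proof.
move=> n6; rewrite -(subnKC n6); elim: (n - 6)%N => [|k IH].
  by rewrite addn0; exact: octahedron_sphere.
rewrite addnS; exact: (@bipyramid_subdivision R (5 + k) (leq_addr _ _) IH).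
Qed.

End Octahedron.

(** Every second vertex of the equator is taken. Odd labels from 3 on avoid both the apexes and the
    vertex 2, so the closing edge {2, n - 1} does no harm. *)
Lemma bipyramid_alpha n : (6 <= n)%N -> ((n - 2) %/ 2 <= alpha (bipyramid n))%N.
Proof.
move=> n6; pose S := [set i : 'I_n | odd i && (3 <= i)%N]%SET.
have st : stable (bipyramid n) S.
  apply/forallP => i; apply/implyP; rewrite inE => /andP[io i3].
  apply/forallP => j; apply/implyP; rewrite inE => /andP[jo j3].
  rewrite bipyramid_adjacent negb_and; apply/orP; right.
  by move: io jo; rewrite /bipyramid_rel; lia.
have : (#|S| <= alpha (bipyramid n))%N by apply: leq_bigmax_cond.
apply: leq_trans.
have lt (k : 'I_((n - 2) %/ 2)) : (k.*2 + 3 < n)%N by have := ltn_ord k; lia.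
pose f k : 'I_n := Ordinal (lt k).
have injf : injective f.
  by move=> i j /(congr1 val) /= h; apply: val_inj; move: h => /=; lia.
rewrite -[X in (X <= _)%N]card_ord -(card_imset predT injf); apply: subset_leq_card.
apply/fintype.subsetP => _ /imsetP[k _ ->]; rewrite inE /=; lia.
Qed.

Lemma sphere_stable_bound (R : realType) n (G : sgraph n) (S : {set 'I_n}) :
  (6 <= n)%N -> triangulates_sphere R 3 (clique_complex G) -> stable G S ->
  (#|S| <= (n - 2) %/ 2)%N.
Proof.
move=> n6 hom; have n0 : (0 < n)%N by lia.
have n1 : (1 < n)%N by lia.
have noiso a : exists b, adjacent G a b.
  have [|ne] := eqVneq a (Ordinal n0); last exact: (no_isolated_vertex hom ne).
  move=> ea; apply: (no_isolated_vertex (v := Ordinal n1) hom).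
  by rewrite ea -(inj_eq val_inj).
apply: (stable_bound n0 noiso) => [a b|s s0 ssym sc]; first exact: (edge_link hom).
have [b ab] := noiso (Ordinal n0); have [c abc] := edge_in_triangle hom ab.
exact: (cocycle_trivial hom ab abc s0 ssym sc).
Qed.

Local Open Scope nat_scope.

Theorem theorem4p2 (R : realType) (n : nat) (hn : 6 <= n) :
  alphaM R 3 n = (n - 2) %/ 2.
Proof.
apply/eqP; rewrite eqn_leq; apply/andP; split.
  apply/bigmax_leqP => G /asboolP hom; apply/bigmax_leqP => S stS.
  exact: (sphere_stable_bound hn hom stS).
apply: leq_trans (bipyramid_alpha hn) _.
by rewrite /alphaM; apply: leq_bigmax_cond; apply/asboolP; exact: bipyramid_sphere.
Qed.
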